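(* Let $E$ be a Banach lattice with the $\sigma$-interpolation property and assume that $E^*$ has order continuous norm. Suppose $u_0\in E^+$ and $\mathcal G$ is a collection of positive linear operators on $E$ such that the adjoint $T^*$ is a lattice homomorphism for each $T\in\mathcal G$, and such that: (a) for every $x\in E^+$ there exists $T\in\mathcal G$ with $x\le\|x\|_E\,Tu_0$; (b) for every disjoint sequence $(x_n)_{n\ge1}$ in $[0,u_0]$ and every sequence $(T_n)_{n\ge1}$ in $\mathcal G$ there exists $v\in E^+$ with $T_nx_n\le v$ for all $n$. Then $E$ is a Grothendieck space.
   Context: A Banach space $X$ is a Grothendieck space if every weak-$*$ convergent sequence in $X^*$ is weakly convergent (i.e. $\sigma(X^*,X)$-convergent sequences are $\sigma(X^*,X^{**})$-convergent). A Banach lattice $E$ has the $\sigma$-interpolation property if for any sequences $(x_n),(y_n)$ in $E$ with $x_n\le x_{n+1}\le y_{n+1}\le y_n$ for all $n$ there exists $z\in E$ with $x_n\le z\le y_n$ for all $n$. *)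

(* Defs.v *)
From Stdlib Require Import Reals.
Open Scope R_scope.

Record BanachLattice := {
  bl_carrier :> Type;
  bl_zero : bl_carrier;
  bl_add : bl_carrier -> bl_carrier -> bl_carrier;
  bl_opp : bl_carrier -> bl_carrier;
  bl_scal : R -> bl_carrier -> bl_carrier;
  bl_norm : bl_carrier -> R;
  bl_le : bl_carrier -> bl_carrier -> Prop;
  bl_join : bl_carrier -> bl_carrier -> bl_carrier;
  bl_meet : bl_carrier -> bl_carrier -> bl_carrier;
  bl_addA : forall x y z, bl_add x (bl_add y z) = bl_add (bl_add x y) z;
  bl_addC : forall x y, bl_add x y = bl_add y x;
  bl_add0 : forall x, bl_add x bl_zero = x;
  bl_addN : forall x, bl_add x (bl_opp x) = bl_zero;
  bl_scalA : forall a b x, bl_scal a (bl_scal b x) = bl_scal (a * b) x;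
  bl_scal1 : forall x, bl_scal 1 x = x;
  bl_scalDr : forall a x y, bl_scal a (bl_add x y) = bl_add (bl_scal a x) (bl_scal a y);
  bl_scalDl : forall a b x, bl_scal (a + b) x = bl_add (bl_scal a x) (bl_scal b x);
  bl_norm_eq0 : forall x, bl_norm x = 0 -> x = bl_zero;
  bl_normZ : forall a x, bl_norm (bl_scal a x) = Rabs a * bl_norm x;
  bl_norm_triangle : forall x y, bl_norm (bl_add x y) <= bl_norm x + bl_norm y;
  bl_complete : forall u : nat -> bl_carrier,
    (forall eps, 0 < eps -> exists N, forall n m, (N <= n)%nat -> (N <= m)%nat ->
        bl_norm (bl_add (u n) (bl_opp (u m))) < eps) ->
    exists l, forall eps, 0 < eps -> exists N, forall n, (N <= n)%nat ->
        bl_norm (bl_add (u n) (bl_opp l)) < eps;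
  bl_le_refl : forall x, bl_le x x;
  bl_le_trans : forall x y z, bl_le x y -> bl_le y z -> bl_le x z;
  bl_le_antisym : forall x y, bl_le x y -> bl_le y x -> x = y;
  bl_le_add : forall x y z, bl_le x y -> bl_le (bl_add x z) (bl_add y z);
  bl_le_scal : forall a x y, 0 <= a -> bl_le x y -> bl_le (bl_scal a x) (bl_scal a y);
  bl_join_l : forall x y, bl_le x (bl_join x y);
  bl_join_r : forall x y, bl_le y (bl_join x y);
  bl_join_lub : forall x y z, bl_le x z -> bl_le y z -> bl_le (bl_join x y) z;
  bl_meet_l : forall x y, bl_le (bl_meet x y) x;
  bl_meet_r : forall x y, bl_le (bl_meet x y) y;
  bl_meet_glb : forall x y z, bl_le z x -> bl_le z y -> bl_le z (bl_meet x y);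
  bl_norm_mono : forall x y,
    bl_le (bl_join x (bl_opp x)) (bl_join y (bl_opp y)) -> bl_norm x <= bl_norm y
}.

Arguments bl_zero {_}.
Arguments bl_add {_} _ _.
Arguments bl_opp {_} _.
Arguments bl_scal {_} _ _.
Arguments bl_norm {_} _.
Arguments bl_le {_} _ _.
Arguments bl_join {_} _ _.
Arguments bl_meet {_} _ _.

Section BL.
Variable E : BanachLattice.

Definition bl_abs (x : E) : E := bl_join x (bl_opp x).

Definition bl_disjoint (x y : E) : Prop := bl_meet (bl_abs x) (bl_abs y) = bl_zero.

Definition sigma_interpolation : Prop :=
  forall xs ys : nat -> E,
    (forall n, bl_le (xs n) (xs (S n)) /\ bl_le (xs (S n)) (ys (S n))
               /\ bl_le (ys (S n)) (ys n)) ->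
    exists z : E, forall n, bl_le (xs n) z /\ bl_le z (ys n).

Definition linear_op (T : E -> E) : Prop :=
  (forall x y, T (bl_add x y) = bl_add (T x) (T y)) /\
  (forall a x, T (bl_scal a x) = bl_scal a (T x)).

Definition positive_linear_op (T : E -> E) : Prop :=
  linear_op T /\ forall x, bl_le bl_zero x -> bl_le bl_zero (T x).

Definition linear_functional (f : E -> R) : Prop :=
  (forall x y, f (bl_add x y) = f x + f y) /\
  (forall a x, f (bl_scal a x) = a * f x).

(** [dual_bound f c] : ||f|| <= c  (for c >= 0) *)
Definition dual_bound (f : E -> R) (c : R) : Prop :=
  forall x, Rabs (f x) <= c * bl_norm x.

Definition in_dual (f : E -> R) : Prop :=
  linear_functional f /\ exists c, dual_bound f c.

Definition dual_le (f g : E -> R) : Prop :=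
  forall x, bl_le bl_zero x -> f x <= g x.

Definition dual_is_sup (f g h : E -> R) : Prop :=
  in_dual h /\ dual_le f h /\ dual_le g h /\
  forall k, in_dual k -> dual_le f k -> dual_le g k -> dual_le h k.

Definition dual_is_inf (D : (E -> R) -> Prop) (g : E -> R) : Prop :=
  in_dual g /\ (forall f, D f -> dual_le g f) /\
  forall k, in_dual k -> (forall f, D f -> dual_le k f) -> dual_le k g.

Definition adjoint (T : E -> E) (f : E -> R) : E -> R := fun x => f (T x).

Definition adjoint_lattice_hom (T : E -> E) : Prop :=
  forall f g h, in_dual f -> in_dual g -> dual_is_sup f g h ->
    dual_is_sup (adjoint T f) (adjoint T g) (adjoint T h).

(** E^* has order continuous norm: whenever D is a downward directed subset
    of E^* with infimum 0 (i.e. a net decreasing to 0), inf_{f in D} ||f|| = 0. *)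
Definition dual_order_continuous : Prop :=
  forall D : (E -> R) -> Prop,
    (forall f, D f -> in_dual f) ->
    (exists f, D f) ->
    (forall f g, D f -> D g -> exists h, D h /\ dual_le h f /\ dual_le h g) ->
    dual_is_inf D (fun _ => 0) ->
    forall eps, 0 < eps -> exists f, D f /\ exists c, 0 <= c /\ c < eps /\ dual_bound f c.

Definition in_bidual (phi : (E -> R) -> R) : Prop :=
  (forall f g, in_dual f -> in_dual g -> phi (fun x => f x + g x) = phi f + phi g) /\
  (forall a f, in_dual f -> phi (fun x => a * f x) = a * phi f) /\
  exists C, forall f c, in_dual f -> 0 <= c -> dual_bound f c -> Rabs (phi f) <= C * c.

Definition grothendieck : Prop :=
  forall (fs : nat -> E -> R) (f : E -> R),
    (forall n, in_dual (fs n)) -> in_dual f ->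
    (forall x, Un_cv (fun n => fs n x) (f x)) ->
    exists g, in_dual g /\
      forall phi, in_bidual phi -> Un_cv (fun n => phi (fs n)) (phi g).

End BL.

Arguments sigma_interpolation : clear implicits.
Arguments dual_order_continuous : clear implicits.
Arguments grothendieck : clear implicits.

(* Main.v *)
From mathcomp Require filter.
Require Import Defs.
From Stdlib Require Import Reals Lra Lia List Classical ClassicalEpsilon.
From Stdlib Require Import FunctionalExtensionality ProofIrrelevance.
Import ListNotations.
Open Scope R_scope.

(* Let f_n -> 0 weak-* with phi (f_n) >= eps for some phi in the bidual.  By the
   sigma-interpolation property a sliding hump argument shows that the |f_n| are uniformly
   small on the terms of any order bounded series.  Suppose first that the tails
   (f_n^+ - H)^+ are not uniformly phi-small for large H in the dual.  Then there are almost
   disjoint g_k <= f_(n_k)^+ on which phi is bounded away from 0, so long signed sums of g_k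
   have large norm, and (a) yields T in G for which many of the pairwise disjoint functionals
   T^* g_k (T^* is a lattice homomorphism) are large at u0.  From such rows one extracts a
   disjoint sequence y_j in [0, u0] with g_(k_j) (T_j y_j) bounded below; by (b) the almost
   disjoint g_(k_j) are then bounded below at one element v, which the hump argument excludes.
   So the tails are uniformly phi-small.  The truncations of f_n^+ and f_n^- at H lie in an
   order interval; subtracting their limit along an ultrafilter, which has small norm because
   the norm of the dual is order continuous, one finds midpoint combinations of small norm,
   and phi cannot be bounded below on them. *)

(** * Riesz spaces *)

(** Neither band projections nor representing measures are used in the dual; disjointness there is
    made quantitative. The functional g_k lies below (f_(n_k)^+ - 2^k f_(n_i)^+)^+ for every i < k.
    Subtracting a finite sum of terms 2^(-k) f_(n_k)^+ with k >= K makes the remainders exactly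
    disjoint, and the weights keep the removed norm at most 2 C 2^(-K). Rows are therefore long but
    finite. Balls of the dual need not be weak-* sequentially compact, so limits run along one
    ultrafilter instead of subsequences. Such limits respect order but not lattice operations; hence
    the truncations at H have limits of their own, which must be compared with the limits of f_n^+
    and f_n^-. Order continuity of the dual norm enters twice: it makes those limits close in norm
    for some large H, and it upgrades smallness on a single interval [0, x] to smallness in norm.
    Smallness on [0, x] is a Hilbert space argument: H plays the part of a measure, functionals
    between -H and H that of bounded densities, and energies over finite partitions replace the L^2
    norm. *)

Record Riesz := {
  rz_car :> Type;
  rz0 : rz_car;
  rz_add : rz_car -> rz_car -> rz_car;
  rz_opp : rz_car -> rz_car;
  rz_scal : R -> rz_car -> rz_car;
  rz_le : rz_car -> rz_car -> Prop;
  join : rz_car -> rz_car -> rz_car;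
  meet : rz_car -> rz_car -> rz_car;
  rz_addA : forall x y z, rz_add x (rz_add y z) = rz_add (rz_add x y) z;
  rz_addC : forall x y, rz_add x y = rz_add y x;
  rz_add0 : forall x, rz_add x rz0 = x;
  rz_addN : forall x, rz_add x (rz_opp x) = rz0;
  rz_scalA : forall a b x, rz_scal a (rz_scal b x) = rz_scal (a * b) x;
  rz_scal1 : forall x, rz_scal 1 x = x;
  rz_scalDr : forall a x y, rz_scal a (rz_add x y) = rz_add (rz_scal a x) (rz_scal a y);
  rz_scalDl : forall a b x, rz_scal (a + b) x = rz_add (rz_scal a x) (rz_scal b x);
  rz_le_refl : forall x, rz_le x x;
  rz_le_trans : forall x y z, rz_le x y -> rz_le y z -> rz_le x z;
  rz_le_antisym : forall x y, rz_le x y -> rz_le y x -> x = y;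
  rz_le_add : forall x y z, rz_le x y -> rz_le (rz_add x z) (rz_add y z);
  rz_le_scal : forall a x y, 0 <= a -> rz_le x y -> rz_le (rz_scal a x) (rz_scal a y);
  join_l : forall x y, rz_le x (join x y);
  join_r : forall x y, rz_le y (join x y);
  join_lub : forall x y z, rz_le x z -> rz_le y z -> rz_le (join x y) z;
  meet_l : forall x y, rz_le (meet x y) x;
  meet_r : forall x y, rz_le (meet x y) y;
  meet_glb : forall x y z, rz_le z x -> rz_le z y -> rz_le z (meet x y)
}.

Arguments rz_car _ : simpl never.
Arguments rz0 {_} : simpl never.
Arguments rz_add {_} _ _ : simpl never.
Arguments rz_opp {_} _ : simpl never.
Arguments rz_scal {_} _ _ : simpl never.
Arguments rz_le {_} _ _ : simpl never.
Arguments join {_} _ _ : simpl never.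
Arguments meet {_} _ _ : simpl never.
Arguments rz_addA {_}. Arguments rz_addC {_}. Arguments rz_add0 {_}.
Arguments rz_addN {_}. Arguments rz_scalA {_}. Arguments rz_scal1 {_}.
Arguments rz_scalDr {_}. Arguments rz_scalDl {_}. Arguments rz_le_refl {_}.
Arguments rz_le_trans {_}. Arguments rz_le_antisym {_}.
Arguments rz_le_add {_}. Arguments rz_le_scal {_}.
Arguments join_l {_}. Arguments join_r {_}. Arguments join_lub {_}.
Arguments meet_l {_}. Arguments meet_r {_}. Arguments meet_glb {_}.

Notation "x [+] y" := (rz_add x y) (at level 50, left associativity).
Notation "[-] x" := (rz_opp x) (at level 35, right associativity).
Notation "x [-] y" := (rz_add x (rz_opp y)) (at level 50, left associativity).
Notation "a [*] x" := (rz_scal a x) (at level 40, left associativity).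
Notation "x [<=] y" := (rz_le x y) (at level 70, no associativity).

Definition vpos {V : Riesz} (x : V) : V := join x rz0.
Definition vabs {V : Riesz} (x : V) : V := join x ([-] x).
Fixpoint vsum {V : Riesz} (w : nat -> V) (n : nat) : V :=
  match n with O => rz0 | S n => vsum w n [+] w n end.

Fixpoint lsum {V : Riesz} (l : list V) : V :=
  match l with nil => rz0 | x :: l => x [+] lsum l end.

Section VectorIdentities.
Context {V : Riesz}.
Implicit Types x y : V.

Lemma rz_add0l x : rz0 [+] x = x.
Proof. now rewrite rz_addC, rz_add0. Qed.

Lemma rz_add_cancel x y z : x [+] z = y [+] z -> x = y.
Proof.
  intros H. rewrite <- (rz_add0 x), <- (rz_add0 y), <- (rz_addN z), !rz_addA.
  now rewrite H.
Qed.

Lemma rz_scal0 x : 0 [*] x = rz0.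
Proof.
  apply rz_add_cancel with (0 [*] x).
  rewrite <- rz_scalDl, rz_add0l. f_equal; lra.
Qed.

Lemma rz_scal_zero a : a [*] (rz0 : V) = rz0.
Proof.
  apply rz_add_cancel with (a [*] rz0).
  now rewrite <- rz_scalDr, !rz_add0l.
Qed.

Lemma rz_oppE x : [-] x = (-1) [*] x.
Proof.
  apply rz_add_cancel with x. rewrite rz_addC, rz_addN.
  rewrite <- (rz_scal1 x) at 2. rewrite <- rz_scalDl.
  replace (-1 + 1) with 0 by lra. now rewrite rz_scal0.
Qed.

Lemma rz_addACA (a b c d : V) : (a [+] b) [+] (c [+] d) = (a [+] c) [+] (b [+] d).
Proof.
  rewrite !rz_addA. f_equal. rewrite <- !rz_addA. f_equal. apply rz_addC.
Qed.

(* Linear identities are decided by comparing the coefficients of reified expressions. *)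
Inductive vexp :=
  | VA (n : nat) | V0 | VAdd (e f : vexp) | VOpp (e : vexp) | VScal (a : R) (e : vexp).

Fixpoint veval (env : list V) (e : vexp) : V :=
  match e with
  | VA n => nth n env rz0
  | V0 => rz0
  | VAdd e f => veval env e [+] veval env f
  | VOpp e => [-] veval env e
  | VScal a e => a [*] veval env e
  end.

Fixpoint coef (e : vexp) (k : nat) : R :=
  match e with
  | VA n => if Nat.eqb n k then 1 else 0
  | V0 => 0
  | VAdd e f => coef e k + coef f k
  | VOpp e => - coef e k
  | VScal a e => a * coef e k
  end.

Fixpoint lincomb (env : list V) (c : nat -> R) : V :=
  match env with
  | nil => rz0
  | x :: env => c O [*] x [+] lincomb env (fun n => c (S n))
  end.

(** A finite conjunction over the environment, so that [cbn] leaves finitely many equations between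
    reals. *)
Fixpoint coef_eq (n : nat) (c d : nat -> R) : Prop :=
  match n with
  | O => True
  | S n => c O = d O /\ coef_eq n (fun k => c (S k)) (fun k => d (S k))
  end.

Lemma lincomb_ext env : forall c d, coef_eq (length env) c d -> lincomb env c = lincomb env d.
Proof.
  induction env as [|x env IH]; simpl; intros c d H; [reflexivity|].
  destruct H as [H1 H2]. now rewrite H1, (IH _ _ H2).
Qed.

Lemma coef_eq_pointwise n : forall c d, (forall k, c k = d k) -> coef_eq n c d.
Proof. induction n; simpl; intros c d H; [exact I|]. split; [apply H|]. apply IHn; intros; apply H. Qed.

Lemma lincomb0 env : lincomb env (fun _ => 0) = rz0.
Proof. induction env as [|x env IH]; simpl; [reflexivity|]. now rewrite IH, rz_scal0, rz_add0. Qed.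

Lemma lincombD env : forall c d, lincomb env (fun k => c k + d k) = lincomb env c [+] lincomb env d.
Proof.
  induction env as [|x env IH]; simpl; intros c d; [now rewrite rz_add0|].
  now rewrite IH, rz_scalDl, rz_addACA.
Qed.

Lemma lincombZ env a : forall c, lincomb env (fun k => a * c k) = a [*] lincomb env c.
Proof.
  induction env as [|x env IH]; simpl; intros c; [now rewrite rz_scal_zero|].
  now rewrite IH, rz_scalDr, rz_scalA.
Qed.

Lemma lincomb_atom env : forall n, lincomb env (coef (VA n)) = nth n env rz0.
Proof.
  induction env as [|x env IH]; intros n; simpl; [now destruct n|].
  destruct n as [|n]; simpl.
  - rewrite rz_scal1. rewrite lincomb0. apply rz_add0.
  - rewrite rz_scal0, rz_add0l. apply IH.
Qed.

Lemma veval_lincomb env e : veval env e = lincomb env (coef e).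
Proof.
  induction e as [n| |e IHe f IHf|e IH|a e IH]; cbn [veval].
  - symmetry; apply lincomb_atom.
  - symmetry; apply lincomb0.
  - rewrite IHe, IHf. symmetry; apply lincombD.
  - rewrite IH, rz_oppE, <- lincombZ. apply lincomb_ext, coef_eq_pointwise.
    intros k; simpl; lra.
  - rewrite IH. symmetry; apply lincombZ.
Qed.

Lemma veval_eq env e f : coef_eq (length env) (coef e) (coef f) -> veval env e = veval env f.
Proof. intros H. rewrite !veval_lincomb. now apply lincomb_ext. Qed.

End VectorIdentities.

Ltac vs_mem x l :=
  match l with
  | nil => constr:(false)
  | x :: _ => constr:(true)
  | _ :: ?l => vs_mem x l
  end.
Ltac vs_atoms t l :=
  lazymatch t with
  | rz0 => l
  | rz_add ?a ?b => let l := vs_atoms a l in vs_atoms b l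
  | rz_opp ?a => vs_atoms a l
  | rz_scal _ ?a => vs_atoms a l
  | _ => match vs_mem t l with true => l | false => constr:(t :: l) end
  end.
Ltac vs_index t l :=
  match l with
  | t :: _ => constr:(O)
  | _ :: ?l => let n := vs_index t l in constr:(S n)
  end.
Ltac vs_reify t l :=
  lazymatch t with
  | rz0 => constr:(V0)
  | rz_add ?a ?b => let a := vs_reify a l in let b := vs_reify b l in constr:(VAdd a b)
  | rz_opp ?a => let a := vs_reify a l in constr:(VOpp a)
  | rz_scal ?r ?a => let a := vs_reify a l in constr:(VScal r a)
  | _ => let n := vs_index t l in constr:(VA n)
  end.
Ltac vs :=
  lazymatch goal with
  | |- @eq ?T ?a ?b =>
    let l := vs_atoms a (@nil T) in
    let l := vs_atoms b l in
    let ea := vs_reify a l in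
    let eb := vs_reify b l in
    apply (veval_eq l ea eb);
    cbn [length coef_eq coef Nat.eqb]; repeat split; try (lra || ring || (field; lra))
  end.

Section RieszFacts.
Context {V : Riesz}.
Implicit Types a b c d x y z : V.

Lemma le_diff0 x y : x [<=] y <-> rz0 [<=] y [-] x.
Proof.
  split; intros H.
  - apply (rz_le_add _ _ ([-] x)) in H. now rewrite rz_addN in H.
  - apply (rz_le_add _ _ x) in H. replace (rz0 [+] x) with x in H by vs.
    now replace (y [-] x [+] x) with y in H by vs.
Qed.

Lemma le_add_mono a b c d : a [<=] b -> c [<=] d -> a [+] c [<=] b [+] d.
Proof.
  intros H1 H2. apply rz_le_trans with (b [+] c); [now apply rz_le_add|].
  rewrite (rz_addC b c), (rz_addC b d). now apply rz_le_add.
Qed.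

(** With [vle2] this turns a linear inequality into a certificate: name the inequalities to be
    added, and [vs] checks the remaining identity. *)
Lemma vle1 a b c d : c [<=] d -> b [-] a = d [-] c -> a [<=] b.
Proof. intros H E. apply le_diff0. rewrite E. now apply le_diff0 in H. Qed.

Lemma vle2 a b c1 d1 c2 d2 : c1 [<=] d1 -> c2 [<=] d2 ->
  b [-] a = (d1 [-] c1) [+] (d2 [-] c2) -> a [<=] b.
Proof.
  intros H1 H2 E. apply (vle1 _ _ _ _ (le_add_mono _ _ _ _ H1 H2)).
  rewrite E. vs.
Qed.

Lemma scal_nonneg r x : 0 <= r -> rz0 [<=] x -> rz0 [<=] r [*] x.
Proof. intros Hr Hx. rewrite <- (rz_scal_zero r). now apply rz_le_scal. Qed.

Lemma add_nonneg x y : rz0 [<=] x -> rz0 [<=] y -> rz0 [<=] x [+] y.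
Proof. intros H1 H2. apply (vle2 _ _ _ _ _ _ H1 H2). vs. Qed.

Lemma vsum_nonneg (w : nat -> V) n : (forall i, rz0 [<=] w i) -> rz0 [<=] vsum w n.
Proof.
  intros H; induction n; simpl; [apply rz_le_refl|]. now apply add_nonneg.
Qed.

Lemma pos_nonneg x : rz0 [<=] vpos x.
Proof. apply join_r. Qed.
Lemma pos_ge x : x [<=] vpos x.
Proof. apply join_l. Qed.
Lemma pos_lub x y : x [<=] y -> rz0 [<=] y -> vpos x [<=] y.
Proof. apply join_lub. Qed.
Lemma pos_mono x y : x [<=] y -> vpos x [<=] vpos y.
Proof.
  intros H. apply pos_lub; [|apply pos_nonneg].
  apply rz_le_trans with y; [assumption|apply pos_ge].
Qed.
Lemma pos_id x : rz0 [<=] x -> vpos x = x.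
Proof. intros H. apply rz_le_antisym; [apply pos_lub; auto using rz_le_refl|apply pos_ge]. Qed.

Lemma join_meet_add x y : join x y [+] meet x y = x [+] y.
Proof.
  apply rz_le_antisym.
  - assert (H : join x y [<=] x [+] y [-] meet x y).
    { apply join_lub.
      - apply (vle1 _ _ _ _ (meet_r x y)). vs.
      - apply (vle1 _ _ _ _ (meet_l x y)). vs. }
    apply (vle1 _ _ _ _ H). vs.
  - assert (H : x [+] y [-] join x y [<=] meet x y).
    { apply meet_glb.
      - apply (vle1 _ _ _ _ (join_r x y)). vs.
      - apply (vle1 _ _ _ _ (join_l x y)). vs. }
    apply (vle1 _ _ _ _ H). vs.
Qed.

Lemma meetC x y : meet x y = meet y x.
Proof. apply rz_le_antisym; apply meet_glb; auto using meet_l, meet_r. Qed.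

Lemma meet_mono a b c d : a [<=] b -> c [<=] d -> meet a c [<=] meet b d.
Proof.
  intros H1 H2. apply meet_glb.
  - apply rz_le_trans with a; [apply meet_l|assumption].
  - apply rz_le_trans with c; [apply meet_r|assumption].
Qed.

Lemma pos_sub_meet x y : vpos (x [-] y) = x [-] meet x y.
Proof.
  apply rz_le_antisym.
  - apply pos_lub.
    + apply (vle1 _ _ _ _ (meet_r x y)). vs.
    + apply (vle1 _ _ _ _ (meet_l x y)). vs.
  - assert (H : x [-] vpos (x [-] y) [<=] meet x y).
    { apply meet_glb.
      - apply (vle1 _ _ _ _ (pos_nonneg (x [-] y))). vs.
      - apply (vle1 _ _ _ _ (pos_ge (x [-] y))). vs. }
    apply (vle1 _ _ _ _ H). vs.
Qed.

Lemma pos_scal r x : 0 < r -> vpos (r [*] x) = r [*] vpos x.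
Proof.
  intros Hr.
  assert (Hle : forall s y, 0 < s -> vpos (s [*] y) [<=] s [*] vpos y).
  { intros s y Hs. apply pos_lub.
    - apply rz_le_scal; [lra|apply pos_ge].
    - apply scal_nonneg; [lra|apply pos_nonneg]. }
  apply rz_le_antisym; [now apply Hle|].
  assert (H := Hle (/ r) (r [*] x) (Rinv_0_lt_compat _ Hr)).
  apply (rz_le_scal r) in H; [|lra].
  replace (/ r [*] (r [*] x)) with x in H by vs.
  now replace (r [*] (/ r [*] vpos (r [*] x))) with (vpos (r [*] x)) in H by vs.
Qed.

Definition disjoint x y := meet x y = rz0.

Lemma disjointC x y : disjoint x y -> disjoint y x.
Proof. unfold disjoint. now rewrite meetC. Qed.

Lemma disjoint_of_le x y : rz0 [<=] x -> rz0 [<=] y -> meet x y [<=] rz0 -> disjoint x y.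
Proof. intros. apply rz_le_antisym; auto using meet_glb. Qed.

Lemma disjoint_mono a b x y : rz0 [<=] a -> rz0 [<=] b -> a [<=] x -> b [<=] y ->
  disjoint x y -> disjoint a b.
Proof.
  intros Ha Hb H1 H2 H. apply disjoint_of_le; auto.
  rewrite <- H. now apply meet_mono.
Qed.

(** If [m] is the meet of x - x∧y and y - x∧y, then x∧y + m is still a lower bound of [x] and [y],
    so [m] is at most zero. *)
Lemma disjoint_pos_sub x y : disjoint (vpos (x [-] y)) (vpos (y [-] x)).
Proof.
  unfold disjoint. rewrite !pos_sub_meet, (meetC y x).
  apply rz_le_antisym.
  - set (m := meet (x [-] meet x y) (y [-] meet x y)).
    assert (H : meet x y [+] m [<=] meet x y).
    { apply meet_glb.
      - apply (vle1 _ _ _ _ (meet_l (x [-] meet x y) (y [-] meet x y))). fold m. vs.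
      - apply (vle1 _ _ _ _ (meet_r (x [-] meet x y) (y [-] meet x y))). fold m. vs. }
    apply (vle1 _ _ _ _ H). vs.
  - apply meet_glb; apply le_diff0.
    + apply (vle1 _ _ _ _ (meet_l x y)). vs.
    + apply (vle1 _ _ _ _ (meet_r x y)). vs.
Qed.

Lemma meet_add_le a b c : rz0 [<=] a -> rz0 [<=] b -> rz0 [<=] c ->
  meet a (b [+] c) [<=] meet a b [+] meet a c.
Proof.
  intros Ha Hb Hc. set (m := meet a (b [+] c)).
  assert (m1 : m [<=] a) by apply meet_l.
  assert (m2 : m [<=] b [+] c) by apply meet_r.
  assert (H : m [-] meet a b [<=] meet a c).
  { apply meet_glb.
    - apply (vle2 _ _ _ _ _ _ (meet_glb _ _ _ Ha Hb) m1). vs.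
    - assert (H : m [-] c [<=] meet a b).
      { apply meet_glb.
        - apply (vle2 _ _ _ _ _ _ m1 Hc). vs.
        - apply (vle1 _ _ _ _ m2). vs. }
      apply (vle1 _ _ _ _ H). vs. }
  apply (vle1 _ _ _ _ H). vs.
Qed.

Lemma disjoint_add x y z : rz0 [<=] x -> rz0 [<=] y -> rz0 [<=] z ->
  disjoint x y -> disjoint x z -> disjoint x (y [+] z).
Proof.
  intros Hx Hy Hz H1 H2. apply disjoint_of_le; auto using add_nonneg.
  replace rz0 with (meet x y [+] meet x z).
  - now apply meet_add_le.
  - unfold disjoint in *. rewrite H1, H2. apply rz_add0.
Qed.

Lemma meet_scal r x y : 0 < r -> meet (r [*] x) (r [*] y) = r [*] meet x y.
Proof.
  intros Hr. assert (H := pos_sub_meet (r [*] x) (r [*] y)).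
  replace (r [*] x [-] r [*] y) with (r [*] (x [-] y)) in H by vs.
  rewrite pos_scal, pos_sub_meet in H by assumption.
  replace (meet (r [*] x) (r [*] y))
    with (r [*] x [-] (r [*] x [-] meet (r [*] x) (r [*] y))) by vs.
  rewrite <- H. vs.
Qed.

Lemma disjoint_scal r s x y : 0 <= r -> 0 <= s -> rz0 [<=] x -> rz0 [<=] y ->
  disjoint x y -> disjoint (r [*] x) (s [*] y).
Proof.
  intros Hr Hs Hx Hy H.
  (* One common positive factor dominates both [r] and [s], and [meet_scal] handles equal
     factors. *)
  assert (Hm : 0 < r + s + 1) by lra.
  apply disjoint_mono with ((r + s + 1) [*] x) ((r + s + 1) [*] y);
    try (apply scal_nonneg; lra || assumption).
  - assert (0 <= s + 1) by lra.
    apply (vle1 _ _ _ _ (scal_nonneg _ _ H0 Hx)). vs.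
  - assert (0 <= r + 1) by lra.
    apply (vle1 _ _ _ _ (scal_nonneg _ _ H0 Hy)). vs.
  - unfold disjoint in *. rewrite meet_scal, H by assumption. apply rz_scal_zero.
Qed.

Lemma join_disjoint x y : disjoint x y -> join x y = x [+] y.
Proof. intros H. rewrite <- join_meet_add, H. symmetry; apply rz_add0. Qed.

(** Disjointness expressed through a supremum alone, the form in which a lattice homomorphism
    transports it. *)
Lemma disjoint_of_join x y : join x y = x [+] y -> disjoint x y.
Proof.
  intros H. assert (E := join_meet_add x y). rewrite H in E. unfold disjoint.
  replace (meet x y) with (x [+] y [+] meet x y [-] (x [+] y)) by vs. rewrite E. vs.
Qed.

Lemma decomp x : x = vpos x [-] vpos ([-] x).
Proof.
  assert (H1 := pos_sub_meet x rz0). assert (H2 := pos_sub_meet rz0 x).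
  replace (x [-] rz0) with x in H1 by vs. replace (rz0 [-] x) with ([-] x) in H2 by vs.
  rewrite H1, H2, (meetC rz0 x). vs.
Qed.

(** The two parts are disjoint, so their sum is their join, which [vabs x] dominates once it is
    known to be nonnegative. *)
Lemma vabsE x : vabs x = vpos x [+] vpos ([-] x).
Proof.
  apply rz_le_antisym.
  - apply join_lub.
    + apply (vle2 _ _ _ _ _ _ (pos_ge x) (pos_nonneg ([-] x))). vs.
    + apply (vle2 _ _ _ _ _ _ (pos_ge ([-] x)) (pos_nonneg x)). vs.
  - assert (H1 := disjoint_pos_sub x rz0).
    replace (x [-] rz0) with x in H1 by vs. replace (rz0 [-] x) with ([-] x) in H1 by vs.
    rewrite <- (join_disjoint _ _ H1).
    assert (H0 : rz0 [<=] vabs x).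
    { assert (H := le_add_mono _ _ _ _ (join_l x ([-] x)) (join_r x ([-] x))).
      apply (rz_le_scal (/2)) in H; [|lra]. fold (vabs x) in H.
      apply (vle1 _ _ _ _ H). vs. }
    apply join_lub; apply pos_lub; auto; [apply join_l|apply join_r].
Qed.

Lemma vabs_nonneg x : rz0 [<=] vabs x.
Proof. rewrite vabsE. apply add_nonneg; apply pos_nonneg. Qed.

Lemma vabs_id x : rz0 [<=] x -> vabs x = x.
Proof.
  intros H. rewrite vabsE, (pos_id x H).
  replace (vpos ([-] x)) with (rz0 : V); [apply rz_add0|].
  apply rz_le_antisym; [apply pos_nonneg|].
  apply pos_lub; [|apply rz_le_refl]. apply (vle1 _ _ _ _ H). vs.
Qed.

Lemma vabs_le x y : x [<=] y -> [-] x [<=] y -> vabs x [<=] y.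
Proof. apply join_lub. Qed.

Lemma riesz_decomp x a b : rz0 [<=] x -> rz0 [<=] a -> rz0 [<=] b -> x [<=] a [+] b ->
  exists x1 x2, rz0 [<=] x1 /\ rz0 [<=] x2 /\ x1 [<=] a /\ x2 [<=] b /\ x = x1 [+] x2.
Proof.
  intros Hx Ha Hb H. exists (meet x a), (vpos (x [-] a)).
  repeat split.
  - now apply meet_glb.
  - apply pos_nonneg.
  - apply meet_r.
  - apply pos_lub; [|assumption]. apply (vle1 _ _ _ _ H). vs.
  - rewrite pos_sub_meet. vs.
Qed.

Lemma vsum_disjoint (y : nat -> V) z n : (forall i, rz0 [<=] y i) -> rz0 [<=] z ->
  (forall i, (i < n)%nat -> disjoint z (y i)) -> disjoint z (vsum y n).
Proof.
  intros Hy Hz H. induction n as [|n IH]; simpl.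
  - apply disjoint_of_le; auto using rz_le_refl. apply meet_r.
  - apply disjoint_add; auto using vsum_nonneg.
Qed.

(** For disjoint positive elements sums are suprema; this is what makes a disjoint sequence in an
    order interval an order bounded series. *)
Lemma vsum_disjoint_le (y : nat -> V) v n :
  (forall i, rz0 [<=] y i) -> (forall i, y i [<=] v) -> rz0 [<=] v ->
  (forall i j, i <> j -> disjoint (y i) (y j)) -> vsum y n [<=] v.
Proof.
  intros H0 H1 Hv H2. induction n as [|n IH]; simpl; [assumption|].
  rewrite <- join_disjoint; [now apply join_lub|].
  apply disjointC, vsum_disjoint; auto. intros i Hi. apply H2. lia.
Qed.

End RieszFacts.

(** * Limits along a free ultrafilter *)

Definition free_ultrafilter (U : (nat -> Prop) -> Prop) : Prop :=
  (forall A B : nat -> Prop, U A -> U B -> U (fun n => A n /\ B n)) /\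
  (forall A B : nat -> Prop, (forall n, A n -> B n) -> U A -> U B) /\
  ~ U (fun _ => False) /\
  (forall A : nat -> Prop, U A \/ U (fun n => ~ A n)) /\
  (forall N, U (fun n => (N <= n)%nat)).

Lemma free_ultrafilter_exists : exists U, free_ultrafilter U.
Proof.
  set (F := (fun A : nat -> Prop => exists N, forall n, (N <= n)%nat -> A n)).
  assert (PF : filter.ProperFilter F).
  { constructor.
    - intros [N HN]. exact (HN N (le_n N)).
    - constructor.
      + exists O. intros n _. exact I.
      + intros A B [N1 H1] [N2 H2]. exists (Nat.max N1 N2). intros n Hn.
        split; [apply H1|apply H2]; lia.
      + intros A B HAB [N H]. exists N. intros n Hn. now apply HAB, H. }
  destruct (filter.ultraFilterLemma PF) as [U [HU HF]].
  pose proof (@filter.ultra_proper _ _ HU) as HP.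
  exists U. repeat split.
  - intros A B HA HB. exact (filter.filterI HA HB).
  - intros A B HAB HA. exact (filter.filterS HAB HA).
  - exact (@filter.filter_not_empty _ _ HP).
  - intros A. exact (filter.in_ultra_setVsetC A HU).
  - intros N. apply HF. now exists N.
Qed.

Definition FU : (nat -> Prop) -> Prop :=
  proj1_sig (constructive_indefinite_description _ free_ultrafilter_exists).

Lemma FU_spec : free_ultrafilter FU.
Proof. exact (proj2_sig (constructive_indefinite_description _ free_ultrafilter_exists)). Qed.

Lemma FU_and (A B : nat -> Prop) : FU A -> FU B -> FU (fun n => A n /\ B n).
Proof. apply FU_spec. Qed.
Lemma FU_mono (A B : nat -> Prop) : (forall n, A n -> B n) -> FU A -> FU B.
Proof. apply FU_spec. Qed.
Lemma FU_em (A : nat -> Prop) : FU A \/ FU (fun n => ~ A n).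
Proof. apply FU_spec. Qed.
Lemma FU_tail N : FU (fun n => (N <= n)%nat).
Proof. apply FU_spec. Qed.
Lemma FU_all (A : nat -> Prop) : (forall n, A n) -> FU A.
Proof. intros H. apply (FU_mono _ _ (fun n _ => H n) (FU_tail 0)). Qed.
Lemma FU_ex (A : nat -> Prop) : FU A -> exists n, A n.
Proof.
  intros H. apply NNPP. intros Hn. destruct FU_spec as [_ [_ [HF _]]]. apply HF.
  apply (FU_mono A); [|assumption]. intros n Hn'. apply Hn. now exists n.
Qed.

Definition ucv (a : nat -> R) (l : R) : Prop :=
  forall eps, 0 < eps -> FU (fun n => Rabs (a n - l) < eps).

Lemma ucv_ex (a : nat -> R) C : (forall n, Rabs (a n) <= C) -> exists l, ucv a l.
Proof.
  (* The limit is the supremum of the levels that [a] reaches on a set of the ultrafilter. *)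
  intros HC. set (S := fun t => FU (fun n => t <= a n)).
  assert (HS : bound S).
  { exists C. intros t Ht. destruct (FU_ex _ Ht) as [n Hn]. specialize (HC n).
    apply Rle_trans with (a n); [assumption|]. apply Rle_trans with (2 := HC), Rle_abs. }
  assert (HS' : exists t, S t).
  { exists (- C). apply FU_all. intros n. specialize (HC n).
    assert (H := Rle_abs (- a n)). rewrite Rabs_Ropp in H. lra. }
  destruct (completeness S HS HS') as [l [H1 H2]].
  exists l. intros eps Heps.
  assert (HA : FU (fun n => a n < l + eps)).
  { destruct (FU_em (fun n => l + eps / 2 <= a n)) as [H|H].
    - specialize (H1 _ H). lra.
    - apply FU_mono with (2 := H). intros n Hn. lra. }
  assert (HB : FU (fun n => l - eps < a n)).
  { apply NNPP. intros Hn.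
    assert (l <= l - eps / 2); [|lra].
    apply H2. intros t Ht. apply Rnot_lt_le. intros Hlt. apply Hn.
    apply FU_mono with (2 := Ht). intros n Hn'. lra. }
  apply FU_mono with (2 := FU_and _ _ HA HB). intros n [Hn1 Hn2].
  apply Rabs_def1; lra.
Qed.

Lemma ucv_le (a b : nat -> R) l m : FU (fun n => a n <= b n) -> ucv a l -> ucv b m -> l <= m.
Proof.
  intros H Ha Hb. apply Rnot_lt_le. intros Hlt.
  assert (He : 0 < (l - m) / 2) by lra.
  destruct (FU_ex _ (FU_and _ _ H (FU_and _ _ (Ha _ He) (Hb _ He)))) as [n [H1 [H2 H3]]].
  apply Rabs_def2 in H2, H3. lra.
Qed.

Lemma ucv_unique (a : nat -> R) l m : ucv a l -> ucv a m -> l = m.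
Proof.
  intros H1 H2. apply Rle_antisym; [apply (ucv_le a a)|apply (ucv_le a a)]; auto;
    apply FU_all; intros; lra.
Qed.

Lemma ucv_const c : ucv (fun _ => c) c.
Proof. intros eps H. apply FU_all. intros _. rewrite Rminus_diag, Rabs_R0. assumption. Qed.

Lemma ucv_add (a b : nat -> R) l m : ucv a l -> ucv b m -> ucv (fun n => a n + b n) (l + m).
Proof.
  intros Ha Hb eps He.
  assert (H2 : 0 < eps / 2) by lra.
  apply FU_mono with (2 := FU_and _ _ (Ha _ H2) (Hb _ H2)). intros n [H3 H4].
  apply Rabs_def2 in H3, H4. apply Rabs_def1; lra.
Qed.

Lemma ucv_scal (a : nat -> R) l c : ucv a l -> ucv (fun n => c * a n) (c * l).
Proof.
  intros Ha eps He.
  assert (Hc : 0 < Rabs c + 1) by (pose proof (Rabs_pos c); lra).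
  assert (H2 : 0 < eps / (Rabs c + 1)) by (apply Rdiv_lt_0_compat; lra).
  apply FU_mono with (2 := Ha _ H2). intros n Hn.
  rewrite <- Rmult_minus_distr_l, Rabs_mult.
  apply Rle_lt_trans with ((Rabs c + 1) * Rabs (a n - l)).
  - apply Rmult_le_compat_r; [apply Rabs_pos|lra].
  - apply (Rmult_lt_compat_l (Rabs c + 1)) in Hn; [|lra].
    replace ((Rabs c + 1) * (eps / (Rabs c + 1))) with eps in Hn by (field; lra). lra.
Qed.

Lemma ucv_of_Un_cv (a : nat -> R) l : Un_cv a l -> ucv a l.
Proof.
  intros H eps He. destruct (H eps He) as [N HN].
  apply FU_mono with (2 := FU_tail N). intros n Hn. apply HN. assumption.
Qed.

(** * The Riesz space of bounded functionals *)

Canonical Structure bl_riesz (E : BanachLattice) : Riesz := {|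
  rz_car := bl_carrier E; rz0 := bl_zero; rz_add := bl_add; rz_opp := bl_opp;
  rz_scal := bl_scal; rz_le := bl_le; join := bl_join; meet := bl_meet;
  rz_addA := bl_addA E; rz_addC := bl_addC E; rz_add0 := bl_add0 E;
  rz_addN := bl_addN E; rz_scalA := bl_scalA E; rz_scal1 := bl_scal1 E;
  rz_scalDr := bl_scalDr E; rz_scalDl := bl_scalDl E; rz_le_refl := bl_le_refl E;
  rz_le_trans := bl_le_trans E; rz_le_antisym := bl_le_antisym E;
  rz_le_add := bl_le_add E; rz_le_scal := bl_le_scal E;
  join_l := bl_join_l E; join_r := bl_join_r E; join_lub := bl_join_lub E;
  meet_l := bl_meet_l E; meet_r := bl_meet_r E; meet_glb := bl_meet_glb E |}.

Section Norm.
Context {E : BanachLattice}.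
Implicit Types x y z : bl_riesz E.

Definition nrm (x : bl_riesz E) : R := bl_norm (x : E).

Lemma nrm_scal a x : nrm (a [*] x) = Rabs a * nrm x.
Proof. apply bl_normZ. Qed.
Lemma nrm_triangle x y : nrm (x [+] y) <= nrm x + nrm y.
Proof. apply bl_norm_triangle. Qed.
Lemma nrm0 : nrm (rz0 : bl_riesz E) = 0.
Proof. rewrite <- (rz_scal0 rz0), nrm_scal, Rabs_R0. ring. Qed.
Lemma nrm_opp x : nrm ([-] x) = nrm x.
Proof. rewrite rz_oppE, nrm_scal. replace (Rabs (-1)) with 1; [ring|]. rewrite Rabs_left; lra. Qed.
Lemma nrm_nonneg x : 0 <= nrm x.
Proof.
  assert (H := nrm_triangle x ([-] x)). rewrite rz_addN, nrm0, nrm_opp in H. lra.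
Qed.
Lemma nrm_vabs x : nrm (vabs x) = nrm x.
Proof.
  assert (H : vabs (vabs x) = vabs x) by apply vabs_id, vabs_nonneg.
  apply Rle_antisym; apply bl_norm_mono.
  - change (vabs (vabs x) [<=] vabs x). rewrite H. apply rz_le_refl.
  - change (vabs x [<=] vabs (vabs x)). rewrite H. apply rz_le_refl.
Qed.
Lemma nrm_mono x y : rz0 [<=] x -> x [<=] y -> nrm x <= nrm y.
Proof.
  intros H1 H2. apply bl_norm_mono. change (vabs x [<=] vabs y).
  rewrite !vabs_id; auto. now apply rz_le_trans with x.
Qed.
Lemma nrm_eq0 x : nrm x = 0 -> x = rz0.
Proof. apply bl_norm_eq0. Qed.

Lemma nrm_pos_le x : nrm (vpos x) <= nrm x.
Proof.
  rewrite <- (nrm_vabs x). apply nrm_mono; [apply pos_nonneg|].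
  rewrite vabsE. apply (vle1 _ _ _ _ (pos_nonneg ([-] x))). vs.
Qed.

End Norm.

(** Bundling makes the bounded functionals a type that can carry a [Riesz] structure; proof
    irrelevance reduces equality to equality of values. *)
Record dual (E : BanachLattice) := MkDual { dfun :> bl_riesz E -> R; dualP : in_dual E dfun }.
Arguments MkDual {E} _ _.
Arguments dfun {E} _ _.
Arguments dualP {E} _.

Section Dual.
Context {E : BanachLattice}.
Implicit Types x y z : bl_riesz E.
Implicit Types f g h : dual E.

Lemma dualD f x y : f (x [+] y) = f x + f y.
Proof. apply (dualP f). Qed.
Lemma dualZ f a x : f (a [*] x) = a * f x.
Proof. apply (dualP f). Qed.
Lemma dualN f x : f ([-] x) = - f x.
Proof. rewrite rz_oppE, dualZ. ring. Qed.
Lemma dual0 f : f rz0 = 0.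
Proof. rewrite <- (rz_scal0 rz0), dualZ. ring. Qed.
Lemma dualB f x y : f (x [-] y) = f x - f y.
Proof. rewrite dualD, dualN. ring. Qed.

Lemma dual_ext f g : (forall x, f x = g x) -> f = g.
Proof.
  destruct f as [f Hf], g as [g Hg]; simpl. intros H.
  assert (f = g) by now apply functional_extensionality. subst g.
  f_equal. apply proof_irrelevance.
Qed.

Lemma dual_ext_pos f g : (forall x, rz0 [<=] x -> f x = g x) -> f = g.
Proof.
  intros H. apply dual_ext. intros x. rewrite (decomp x), !dualB.
  now rewrite !H by apply pos_nonneg.
Qed.

Lemma dual_bound_nonneg f : exists c, 0 <= c /\ dual_bound E f c.
Proof.
  destruct (dualP f) as [_ [c Hc]]. exists (Rabs c). split; [apply Rabs_pos|].
  intros x. apply Rle_trans with (1 := Hc x). apply Rmult_le_compat_r; [apply nrm_nonneg|apply Rle_abs].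
Qed.

Lemma in_dual_zero : in_dual E (fun _ => 0).
Proof.
  split; [split; intros; ring|]. exists 0. intros x. rewrite Rabs_R0. lra.
Qed.
Lemma in_dual_add f g : in_dual E (fun x => f x + g x).
Proof.
  split; [split|].
  - intros x y. change (f (x [+] y) + g (x [+] y) = f x + g x + (f y + g y)).
    rewrite !dualD. ring.
  - intros a x. change (f (a [*] x) + g (a [*] x) = a * (f x + g x)).
    rewrite !dualZ. ring.
  - destruct (dualP f) as [_ [c Hc]], (dualP g) as [_ [d Hd]]. exists (c + d). intros x.
    apply Rle_trans with (1 := Rabs_triang _ _). specialize (Hc x). specialize (Hd x). lra.
Qed.
Lemma in_dual_scal a f : in_dual E (fun x => a * f x).
Proof.
  split; [split|].
  - intros x y. change (a * f (x [+] y) = a * f x + a * f y). rewrite dualD. ring.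
  - intros b x. change (a * f (b [*] x) = b * (a * f x)). rewrite dualZ. ring.
  - destruct (dualP f) as [_ [c Hc]]. exists (Rabs a * c). intros x.
    rewrite Rabs_mult, Rmult_assoc. apply Rmult_le_compat_l; [apply Rabs_pos|apply Hc].
Qed.
Lemma in_dual_opp f : in_dual E (fun x => - f x).
Proof.
  replace (fun x => - f x) with (fun x => -1 * f x); [apply in_dual_scal|].
  apply functional_extensionality. intros x. ring.
Qed.

Definition d0 : dual E := MkDual _ in_dual_zero.
Definition dadd f g : dual E := MkDual _ (in_dual_add f g).
Definition dscal a f : dual E := MkDual _ (in_dual_scal a f).
Definition dopp f : dual E := MkDual _ (in_dual_opp f).
Definition dle f g : Prop := dual_le E f g.

(** The extension is s(x^+) - s(x^-). Additivity on the cone gives the same value for every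
    decomposition x = a - b into positive elements, and linearity follows by choosing convenient
    ones. The bound 2c is crude, but only boundedness matters. *)
Lemma cone_extension (s : bl_riesz E -> R) c : 0 <= c ->
  (forall x y, rz0 [<=] x -> rz0 [<=] y -> s (x [+] y) = s x + s y) ->
  (forall a x, 0 < a -> rz0 [<=] x -> s (a [*] x) = a * s x) ->
  (forall x, rz0 [<=] x -> Rabs (s x) <= c * nrm x) ->
  exists f : dual E, forall x, rz0 [<=] x -> f x = s x.
Proof.
  intros Hc HD HZ HB.
  assert (H0 : s rz0 = 0).
  { assert (H := HD rz0 rz0 (rz_le_refl _) (rz_le_refl _)). rewrite rz_add0 in H. lra. }
  set (f := fun x : bl_riesz E => s (vpos x) - s (vpos ([-] x))).
  assert (Hf : forall x a b, rz0 [<=] a -> rz0 [<=] b -> x = a [-] b -> f x = s a - s b).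
  { intros x a b Ha Hb Hx. unfold f.
    assert (Hx' : vpos x [+] b = a [+] vpos ([-] x)).
    { assert (D := decomp x). rewrite Hx in D at 1.
      replace (vpos x [+] b) with (vpos x [-] vpos ([-] x) [+] (b [+] vpos ([-] x))) by vs.
      rewrite <- D. vs. }
    apply (f_equal s) in Hx'. rewrite !HD in Hx'; auto using pos_nonneg. lra. }
  assert (Hin : in_dual E f).
  { split; [split|].
    - intros x y. change (f (x [+] y) = f x + f y).
      rewrite (Hf (x [+] y) (vpos x [+] vpos y) (vpos ([-] x) [+] vpos ([-] y)));
        [|apply add_nonneg; apply pos_nonneg|apply add_nonneg; apply pos_nonneg|].
      + rewrite !HD by apply pos_nonneg. unfold f. ring.
      + rewrite (decomp x) at 1. rewrite (decomp y) at 1. vs.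
    - intros a x. change (f (a [*] x) = a * f x). destruct (Rtotal_order a 0) as [Ha|[Ha|Ha]].
      + rewrite (Hf (a [*] x) ((- a) [*] vpos ([-] x)) ((- a) [*] vpos x)).
        * rewrite !HZ; [unfold f; ring|lra|apply pos_nonneg|lra|apply pos_nonneg].
        * apply scal_nonneg; [lra|apply pos_nonneg].
        * apply scal_nonneg; [lra|apply pos_nonneg].
        * rewrite (decomp x) at 1. vs.
      + subst a. rewrite (Hf (0 [*] x) rz0 rz0); [ring|apply rz_le_refl|apply rz_le_refl|vs].
      + rewrite (Hf (a [*] x) (a [*] vpos x) (a [*] vpos ([-] x))).
        * rewrite !HZ; [unfold f; ring|lra|apply pos_nonneg|lra|apply pos_nonneg].
        * apply scal_nonneg; [lra|apply pos_nonneg].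
        * apply scal_nonneg; [lra|apply pos_nonneg].
        * rewrite (decomp x) at 1. vs.
    - exists (c + c). intros x. unfold f.
      apply Rle_trans with (1 := Rabs_triang _ _). rewrite Rabs_Ropp.
      assert (H1 := HB _ (pos_nonneg x)). assert (H2 := HB _ (pos_nonneg ([-] x))).
      assert (H3 := nrm_pos_le x). assert (H4 := nrm_pos_le ([-] x)). rewrite nrm_opp in H4.
      apply (Rmult_le_compat_l c) in H3; [|lra]. apply (Rmult_le_compat_l c) in H4; [|lra].
      unfold nrm in *. lra. }
  exists (MkDual f Hin). intros x Hx. simpl. rewrite (Hf x x rz0); auto using rz_le_refl.
  - rewrite H0; ring.
  - vs.
Qed.

Definition values_below f x : R -> Prop :=
  fun r => exists y, rz0 [<=] y /\ y [<=] x /\ r = f y.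

(** The Riesz-Kantorovich formula: the supremum of [f] over [0, x] is additive in [x] by Riesz
    decomposition, hence extends from the cone. *)
Lemma dpos_exists f : exists g : dual E, forall x, rz0 [<=] x -> is_lub (values_below f x) (g x).
Proof.
  destruct (dual_bound_nonneg f) as [c [Hc Hb]].
  assert (Hval : forall x r, values_below f x r -> r <= c * nrm x).
  { intros x r [y [Hy [Hyx ->]]]. apply Rle_trans with (1 := Rle_abs _).
    apply Rle_trans with (1 := Hb y). apply Rmult_le_compat_l; [lra|]. now apply nrm_mono. }
  (* Outside the cone [epsilon] returns an arbitrary value, which [cone_extension] never
     consults. *)
  assert (Hs : exists s : bl_riesz E -> R, forall x, rz0 [<=] x -> is_lub (values_below f x) (s x)).
  { exists (fun x => epsilon (inhabits 0) (is_lub (values_below f x))). intros x Hx.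
    apply epsilon_spec.
    destruct (completeness (values_below f x)) as [m Hm].
    - exists (c * nrm x). intros r. apply Hval.
    - exists (f rz0), rz0. auto using rz_le_refl.
    - now exists m. }
  destruct Hs as [s Hs].
  assert (Hsub : forall x y, rz0 [<=] y -> y [<=] x -> f y <= s x).
  { intros x y H1 H2. apply (Hs x); [now apply rz_le_trans with y|]. now exists y. }
  destruct (cone_extension s c) as [g Hg].
  - assumption.
  - intros x y Hx Hy. apply Rle_antisym.
    + apply (Hs (x [+] y)); [now apply add_nonneg|].
      intros r [z [Hz [Hzx ->]]].
      destruct (riesz_decomp z x y) as [z1 [z2 [H1 [H2 [H3 [H4 ->]]]]]]; auto.
      rewrite dualD. apply Rplus_le_compat; auto.
    + assert (s x <= s (x [+] y) - s y); [|lra].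
      apply (Hs x Hx). intros r [z [Hz [Hzx ->]]].
      assert (s y <= s (x [+] y) - f z); [|lra].
      apply (Hs y Hy). intros r [w [Hw [Hwy ->]]].
      assert (f (z [+] w) <= s (x [+] y)); [|rewrite dualD in H; lra].
      apply Hsub; [now apply add_nonneg|now apply le_add_mono].
  - intros a x Ha Hx. 
    (* Used for [a] at [x] and for [/ a] at [a [*] x], which gives both inequalities of
       homogeneity. *)
    assert (Hle : forall b y, 0 < b -> rz0 [<=] y -> b * s y <= s (b [*] y)).
    { intros b y Hb' Hy. apply Rmult_le_reg_l with (/ b); [now apply Rinv_0_lt_compat|].
      rewrite <- Rmult_assoc, Rinv_l, Rmult_1_l by lra.
      apply (Hs y Hy). intros r [z [Hz [Hzx ->]]].
      apply Rmult_le_reg_l with b; [assumption|].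
      rewrite <- Rmult_assoc, Rinv_r, Rmult_1_l, <- dualZ by lra.
      apply Hsub; [apply scal_nonneg; auto; lra|apply rz_le_scal; auto; lra]. }
    apply Rle_antisym; [|now apply Hle].
    assert (H := Hle (/ a) (a [*] x) (Rinv_0_lt_compat _ Ha)).
    replace (/ a [*] (a [*] x)) with x in H by vs.
    apply Rmult_le_reg_l with (/ a); [now apply Rinv_0_lt_compat|].
    rewrite <- Rmult_assoc, Rinv_l, Rmult_1_l by lra. apply H.
    apply scal_nonneg; auto; lra.
  - intros x Hx. apply Rabs_le. split.
    + assert (0 <= s x). { rewrite <- (dual0 f). apply Hsub; auto using rz_le_refl. }
      assert (0 <= c * nrm x) by (apply Rmult_le_pos; [lra|apply nrm_nonneg]). lra.
    + apply (Hs x Hx). intros r. apply Hval.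
  - exists g. intros x Hx. rewrite Hg by assumption. now apply Hs.
Qed.

Definition dpos f : dual E := proj1_sig (constructive_indefinite_description _ (dpos_exists f)).

Lemma dpos_lub f x : rz0 [<=] x -> is_lub (values_below f x) (dpos f x).
Proof. apply (proj2_sig (constructive_indefinite_description _ (dpos_exists f))). Qed.

Lemma dpos_ge f y x : rz0 [<=] y -> y [<=] x -> f y <= dpos f x.
Proof. intros H1 H2. apply dpos_lub; [now apply rz_le_trans with y|]. now exists y. Qed.

Lemma dpos_le f g : dle f g -> dle d0 g -> dle (dpos f) g.
Proof.
  intros H1 H2 x Hx. apply (dpos_lub f x Hx). intros r [y [Hy [Hyx ->]]].
  apply Rle_trans with (1 := H1 y Hy).
  assert (H := H2 (x [-] y) (proj1 (le_diff0 _ _) Hyx)).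
  change (0 <= g (x [-] y)) in H. rewrite dualB in H. lra.
Qed.

Definition djoin f g : dual E := dadd g (dpos (dadd f (dopp g))).
Definition dmeet f g : dual E := dadd f (dopp (dpos (dadd f (dopp g)))).

Lemma djoin_l f g : dle f (djoin f g).
Proof.
  intros x Hx. assert (H := dpos_ge (dadd f (dopp g)) x x Hx (rz_le_refl _)). simpl in *. lra.
Qed.
Lemma djoin_r f g : dle g (djoin f g).
Proof.
  intros x Hx. assert (H := dpos_ge (dadd f (dopp g)) rz0 x (rz_le_refl _) Hx).
  rewrite dual0 in H. simpl in *. lra.
Qed.
Lemma djoin_lub f g h : dle f h -> dle g h -> dle (djoin f g) h.
Proof.
  intros H1 H2 x Hx.
  assert (H := dpos_le (dadd f (dopp g)) (dadd h (dopp g))). simpl in *.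
  assert (dpos (dadd f (dopp g)) x <= h x + - g x); [|lra].
  apply H; auto; intros y Hy; specialize (H1 y Hy); specialize (H2 y Hy); simpl; lra.
Qed.
Lemma dmeet_l f g : dle (dmeet f g) f.
Proof.
  intros x Hx. assert (H := dpos_ge (dadd f (dopp g)) rz0 x (rz_le_refl _) Hx).
  rewrite dual0 in H. simpl in *. lra.
Qed.
Lemma dmeet_r f g : dle (dmeet f g) g.
Proof.
  intros x Hx. assert (H := dpos_ge (dadd f (dopp g)) x x Hx (rz_le_refl _)). simpl in *. lra.
Qed.
Lemma dmeet_glb f g h : dle h f -> dle h g -> dle h (dmeet f g).
Proof.
  intros H1 H2 x Hx.
  assert (H := dpos_le (dadd f (dopp g)) (dadd f (dopp h))). simpl in *.
  assert (dpos (dadd f (dopp g)) x <= f x + - h x); [|lra].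
  apply H; auto; intros y Hy; specialize (H1 y Hy); specialize (H2 y Hy); simpl; lra.
Qed.

Lemma dle_refl f : dle f f.
Proof. intros x _. apply Rle_refl. Qed.
Lemma dle_trans f g h : dle f g -> dle g h -> dle f h.
Proof. intros H1 H2 x Hx. exact (Rle_trans _ _ _ (H1 x Hx) (H2 x Hx)). Qed.
Lemma dle_antisym f g : dle f g -> dle g f -> f = g.
Proof.
  intros H1 H2. apply dual_ext_pos. intros x Hx. exact (Rle_antisym _ _ (H1 x Hx) (H2 x Hx)).
Qed.
Lemma dle_add f g h : dle f g -> dle (dadd f h) (dadd g h).
Proof. intros H x Hx. specialize (H x Hx). simpl. lra. Qed.
Lemma dle_scal a f g : 0 <= a -> dle f g -> dle (dscal a f) (dscal a g).
Proof. intros Ha H x Hx. simpl. apply Rmult_le_compat_l; [assumption|exact (H x Hx)]. Qed.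

End Dual.

(** The lattice lemmas and [vs] now serve functionals as well as vectors. Ending with [Defined]
    keeps the operations transparent, so that [change] can expose their pointwise values. *)
Canonical Structure dual_riesz (E : BanachLattice) : Riesz.
Proof.
  refine {| rz_car := dual E; rz0 := d0; rz_add := dadd; rz_opp := dopp; rz_scal := dscal;
    rz_le := dle; join := djoin; meet := dmeet;
    rz_le_refl := dle_refl; rz_le_trans := dle_trans; rz_le_antisym := dle_antisym;
    rz_le_add := dle_add; rz_le_scal := dle_scal;
    join_l := djoin_l; join_r := djoin_r; join_lub := djoin_lub;
    meet_l := dmeet_l; meet_r := dmeet_r; meet_glb := dmeet_glb |};
    intros; apply dual_ext; intros; simpl; ring.
Defined.

(** * Choice principles and elementary estimates *)

Lemma dependent_choice (X : Type) (P : X -> Prop) (Q : nat -> X -> X -> Prop) :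
  (exists x, P x) -> (forall j x, P x -> exists y, P y /\ Q j x y) ->
  exists u : nat -> X, forall j, P (u j) /\ Q j (u j) (u (S j)).
Proof.
  intros [x0 H0] Hstep.
  assert (F : forall j (s : {x | P x}), {t : {x | P x} | Q j (proj1_sig s) (proj1_sig t)}).
  { intros j [x Hx]. apply constructive_indefinite_description.
    destruct (Hstep j x Hx) as [y [Hy HQ]]. now exists (exist _ y Hy). }
  set (u := fix u n := match n with
                       | O => exist P x0 H0
                       | S n => proj1_sig (F n (u n)) end).
  exists (fun n => proj1_sig (u n)). intros j. split.
  - apply (proj2_sig (u j)).
  - exact (proj2_sig (F j (u j))).
Qed.

Lemma pow2_small (C eps : R) : 0 < eps -> exists n, C * (/ 2) ^ n < eps.
Proof.
  intros He. destruct (pow_lt_1_zero (/ 2)) with (eps / (Rabs C + 1)) as [N HN].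
  - rewrite Rabs_pos_eq; lra.
  - apply Rdiv_lt_0_compat; [lra|]. pose proof (Rabs_pos C). lra.
  - exists N. specialize (HN N (le_n N)).
    assert (Hp : 0 < (/ 2) ^ N) by (apply pow_lt; lra).
    rewrite Rabs_pos_eq in HN by lra.
    assert (HC := Rabs_pos C).
    apply (Rmult_lt_compat_l (Rabs C + 1)) in HN; [|lra].
    replace ((Rabs C + 1) * (eps / (Rabs C + 1))) with eps in HN by (field; lra).
    assert (H := Rle_abs C). nra.
Qed.

Lemma inv_nat_small (C eps : R) : 0 < eps -> exists m : nat, (0 < m)%nat /\ C / INR m < eps.
Proof.
  intros He. destruct (INR_unbounded (Rabs C / eps)) as [m Hm].
  exists (S m). split; [lia|]. rewrite S_INR. assert (Hp := pos_INR m).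
  apply Rmult_lt_reg_r with (INR m + 1); [lra|].
  unfold Rdiv. rewrite Rmult_assoc, Rinv_l, Rmult_1_r by lra.
  apply (Rmult_lt_compat_l eps) in Hm; [|lra].
  replace (eps * (Rabs C / eps)) with (Rabs C) in Hm by (field; lra).
  assert (H := Rle_abs C). lra.
Qed.

Lemma vsum_split {V : Riesz} (u : nat -> V) m n :
  vsum u (m + n) = vsum u m [+] vsum (fun i => u (m + i)%nat) n.
Proof.
  induction n as [|n IH]; simpl.
  - rewrite Nat.add_0_r. vs.
  - rewrite Nat.add_succ_r. simpl. rewrite IH. vs.
Qed.

Lemma vsum_even_odd {V : Riesz} (u : nat -> V) n :
  vsum u (2 * n) = vsum (fun i => u (2 * i)%nat) n [+] vsum (fun i => u (2 * i + 1)%nat) n.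
Proof.
  induction n as [|n IH]; [simpl; vs|].
  replace (2 * S n)%nat with (S (S (2 * n))) by lia. cbn [vsum]. rewrite IH.
  replace (S (2 * n)) with (2 * n + 1)%nat by lia. vs.
Qed.

(** * Positive parts, bounds and disjointness of functionals *)

Section DualFacts.
Context {E : BanachLattice}.
Implicit Types x y z v : bl_riesz E.
Implicit Types f g h : dual E.

Lemma dle_app f g x : f [<=] g -> rz0 [<=] x -> f x <= g x.
Proof. intros H Hx. exact (H x Hx). Qed.

Lemma dual_nonneg f x : rz0 [<=] f -> rz0 [<=] x -> 0 <= f x.
Proof. intros H Hx. exact (H x Hx). Qed.

Lemma dual_mono f x y : rz0 [<=] f -> x [<=] y -> f x <= f y.
Proof.
  intros Hf H. apply le_diff0 in H. assert (H0 := dual_nonneg _ _ Hf H).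
  rewrite dualB in H0. lra.
Qed.

Lemma vpos_dual f : vpos f = dpos f :> dual E.
Proof.
  change (dadd d0 (dpos (dadd f (dopp d0))) = dpos f).
  replace (dadd f (dopp d0)) with f by (apply dual_ext; intros; simpl; ring).
  apply dual_ext; intros; simpl; ring.
Qed.

Lemma vpos_dual_le f x r : rz0 [<=] x -> (forall y, rz0 [<=] y -> y [<=] x -> f y <= r) ->
  vpos f x <= r.
Proof.
  intros Hx H. rewrite vpos_dual. apply (dpos_lub f x Hx).
  intros s [y [H1 [H2 ->]]]. now apply H.
Qed.

Lemma vpos_dual_approx f x eps : rz0 [<=] x -> 0 < eps ->
  exists y, rz0 [<=] y /\ y [<=] x /\ vpos f x - eps < f y.
Proof.
  intros Hx He. apply NNPP. intros Hn.
  assert (vpos f x <= vpos f x - eps); [|lra].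
  apply vpos_dual_le; [assumption|]. intros y H1 H2. apply Rnot_lt_le. intros H.
  apply Hn. now exists y.
Qed.

Lemma dual_abs_le f h x : f [<=] h -> [-] f [<=] h -> rz0 [<=] x -> Rabs (f x) <= h x.
Proof.
  intros H1 H2 Hx. assert (H3 := dle_app _ _ _ H1 Hx). assert (H4 := dle_app _ _ _ H2 Hx).
  change (- f x <= h x) in H4. apply Rabs_le. lra.
Qed.

Lemma dual_vabs f x : rz0 [<=] x -> Rabs (f x) <= vabs f x.
Proof. apply dual_abs_le; [apply join_l|apply join_r]. Qed.

Lemma dual_abs_vabs f x : rz0 [<=] f -> Rabs (f x) <= f (vabs x).
Proof.
  intros Hf. assert (H1 := dual_mono f _ _ Hf (join_l x ([-] x))).
  assert (H2 := dual_mono f _ _ Hf (join_r x ([-] x))).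
  rewrite dualN in H2. apply Rabs_le. unfold vabs. lra.
Qed.

Lemma dual_vabs_vabs f x : Rabs (f x) <= vabs f (vabs x).
Proof.
  rewrite (decomp x) at 1. rewrite dualB, (vabsE x), dualD.
  apply Rle_trans with (1 := Rabs_triang _ _). rewrite Rabs_Ropp.
  apply Rplus_le_compat; apply dual_vabs, pos_nonneg.
Qed.

Lemma dual_bound_pos f c : rz0 [<=] f ->
  (forall x, rz0 [<=] x -> f x <= c * nrm x) -> dual_bound E f c.
Proof.
  intros Hf H x. apply Rle_trans with (1 := dual_abs_vabs f x Hf).
  apply Rle_trans with (1 := H _ (vabs_nonneg x)). rewrite nrm_vabs. apply Rle_refl.
Qed.

Lemma dual_bound_app f c x : dual_bound E f c -> f x <= c * nrm x.
Proof. intros H. apply Rle_trans with (1 := Rle_abs _). apply H. Qed.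

Lemma dual_bound_mono f g c : rz0 [<=] g -> g [<=] f -> dual_bound E f c -> dual_bound E g c.
Proof.
  intros H0 H1 H. apply dual_bound_pos; [assumption|]. intros x Hx.
  apply Rle_trans with (1 := dle_app _ _ _ H1 Hx). now apply dual_bound_app.
Qed.

Lemma dual_bound_vpos f c : 0 <= c -> dual_bound E f c -> dual_bound E (vpos f) c.
Proof.
  intros Hc H. apply dual_bound_pos; [apply pos_nonneg|]. intros x Hx.
  apply vpos_dual_le; [assumption|]. intros y H1 H2.
  apply Rle_trans with (1 := dual_bound_app _ _ y H).
  apply Rmult_le_compat_l; [assumption|]. now apply nrm_mono.
Qed.

Lemma dual_bound_add f g c d : dual_bound E f c -> dual_bound E g d ->
  dual_bound E (f [+] g) (c + d).
Proof.
  intros H1 H2 x. change (Rabs (f x + g x) <= (c + d) * nrm x).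
  apply Rle_trans with (1 := Rabs_triang _ _).
  specialize (H1 x). specialize (H2 x). fold (nrm x) in H1, H2. lra.
Qed.

Lemma dual_bound_scal f a c : dual_bound E f c -> dual_bound E (a [*] f) (Rabs a * c).
Proof.
  intros H x. change (Rabs (a * f x) <= Rabs a * c * nrm x).
  rewrite Rabs_mult, Rmult_assoc. apply Rmult_le_compat_l; [apply Rabs_pos|apply H].
Qed.

(** Disjointness gives (f - g)^+ = f, so a near maximizer [w] of f - g on [0, v] carries almost all
    of [f] and almost none of [g]. *)
Lemma disjoint_split f g v eps : disjoint f g -> rz0 [<=] v -> 0 < eps ->
  exists w, rz0 [<=] w /\ w [<=] v /\ f (v [-] w) + g w < eps.
Proof.
  intros H Hv He.
  destruct (vpos_dual_approx (f [-] g) v eps Hv He) as [w [H1 [H2 H3]]].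
  exists w. repeat split; auto.
  rewrite (pos_sub_meet (f : dual_riesz E)), H in H3.
  change (f v + - 0 - eps < f w + - g w) in H3. rewrite dualB. lra.
Qed.

End DualFacts.

(** * Uniform boundedness and the sliding hump *)

Section UniformBoundedness.
Context {E : BanachLattice}.
Implicit Types x y z : bl_riesz E.

Lemma nrm_sub_triangle x y z : nrm (x [-] z) <= nrm (x [-] y) + nrm (y [-] z).
Proof. replace (x [-] z) with ((x [-] y) [+] (y [-] z)) by vs. apply nrm_triangle. Qed.

(* The radii are chosen one at a time, so no near-norming vectors are needed. *)
Lemma uniform_boundedness (f : nat -> dual E) :
  (forall x, exists B, forall n, Rabs (f n x) <= B) ->
  exists C, 0 <= C /\ forall n, dual_bound E (f n) C.
Proof.
  intros Hpt. apply NNPP. intros Hno.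
  assert (Hbig : forall C, 0 <= C -> exists n u, nrm u = 1 /\ C < Rabs (f n u)).
  { intros C HC. apply NNPP. intros Hn. apply Hno. exists C. split; [assumption|].
    intros n y. apply Rnot_lt_le. intros Hlt.
    assert (Hy := nrm_nonneg y). fold (nrm y) in Hlt.
    assert (Hy0 : 0 < nrm y).
    { destruct Hy as [Hy|Hy]; [assumption|]. exfalso.
      assert (y = rz0) by (apply nrm_eq0; auto). subst y.
      rewrite dual0, Rabs_R0, nrm0 in Hlt. lra. }
    apply Hn. exists n, (/ nrm y [*] y). split.
    - rewrite nrm_scal, Rabs_pos_eq.
      + apply Rinv_l. lra.
      + left. now apply Rinv_0_lt_compat.
    - rewrite dualZ, Rabs_mult, (Rabs_pos_eq (/ nrm y)).
      + apply Rmult_lt_reg_l with (nrm y); [assumption|].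
        rewrite <- Rmult_assoc, Rinv_r, Rmult_1_l by lra. lra.
      + left. now apply Rinv_0_lt_compat. }
  destruct (dependent_choice (bl_riesz E * R) (fun s => 0 < snd s)
    (fun k s t => snd t <= snd s / 2 /\ nrm (fst t [-] fst s) <= snd s /\
       exists n, forall y, nrm (y [-] fst t) <= 2 * snd t -> INR k <= Rabs (f n y)))
    as [u Hu].
  - exists (rz0, 1). simpl. lra.
  - intros k [x r] Hr. simpl in *.
    assert (HC : 0 <= (INR k + 1) / r).
    { left. apply Rdiv_lt_0_compat; [|assumption]. pose proof (pos_INR k). lra. }
    destruct (Hbig _ HC) as [n [e [He1 He2]]].
    assert (He3 : INR k + 1 < r * Rabs (f n e)).
    { apply (Rmult_lt_compat_l r) in He2; [|assumption].
      replace (r * ((INR k + 1) / r)) with (INR k + 1) in He2 by (field; lra). assumption. }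
    (* The values at x + r e and x - r e differ by 2 r f_n(e), so one of them is large in absolute
       value. *)
    assert (Hx : exists x', nrm (x' [-] x) <= r /\ INR k + 1 <= Rabs (f n x')).
    { assert (Hn : forall s, s = r \/ s = - r -> nrm ((x [+] s [*] e) [-] x) <= r).
      { intros s Hs. replace ((x [+] s [*] e) [-] x) with (s [*] e) by vs.
        rewrite nrm_scal, He1. destruct Hs; subst s; [|rewrite Rabs_Ropp];
        rewrite Rabs_pos_eq; lra. }
      destruct (Rle_lt_dec (INR k + 1) (Rabs (f n (x [+] r [*] e)))) as [H|H].
      - exists (x [+] r [*] e). auto.
      - exists (x [+] (- r) [*] e). split; [auto|].
        rewrite !dualD, !dualZ in *.
        assert (H2 : Rabs (2 * (r * f n e)) <= Rabs (f n x + r * f n e) + Rabs (f n x + - r * f n e)).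
        { replace (2 * (r * f n e)) with ((f n x + r * f n e) - (f n x + - r * f n e)) by ring.
          apply Rle_trans with (1 := Rabs_triang _ _). rewrite Rabs_Ropp. lra. }
        rewrite !Rabs_mult, (Rabs_pos_eq 2), (Rabs_pos_eq r) in H2 by lra. lra. }
    destruct Hx as [x' [Hx1 Hx2]].
    destruct (dual_bound_nonneg (f n)) as [c [Hc Hb]].
    (* Chosen so that [f n] varies by at most 1 on the ball of radius 2 r' around [x']; this absorbs
       the 1 in [INR k + 1]. *)
    set (r' := Rmin (r / 2) (/ (2 * (c + 1)))).
    assert (Hr' : 0 < r').
    { apply Rmin_glb_lt; [lra|]. apply Rinv_0_lt_compat. lra. }
    exists (x', r'). simpl. repeat split; auto.
    + apply Rmin_l.
    + exists n. intros y Hy.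
      assert (H : Rabs (f n (y [-] x')) <= 1).
      { apply Rle_trans with (1 := Hb _). fold (nrm (y [-] x')).
        apply Rle_trans with (c * (2 * r')); [now apply Rmult_le_compat_l|].
        assert (H := Rmin_r (r / 2) (/ (2 * (c + 1)))). fold r' in H.
        apply (Rmult_le_compat_l (2 * (c + 1))) in H; [|lra].
        rewrite Rinv_r in H by lra. nra. }
      rewrite dualB in H.
      assert (H2 := Rabs_triang (f n y) (f n x' - f n y)).
      replace (f n y + (f n x' - f n y)) with (f n x') in H2 by ring.
      rewrite (Rabs_minus_sym (f n x')) in H2. lra.
  - cbv beta in Hu.
    assert (Hr : forall k, snd (u k) <= snd (u O) * (/ 2) ^ k).
    { induction k as [|k IH]; simpl; [lra|]. destruct (Hu k) as [_ [H _]]. lra. }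
    (* Since the radii at least halve, each step length is at most twice the drop in radius, and the
       bound telescopes. It explains the factor 2 in the balls above. *)
    assert (Hd : forall k j, nrm (fst (u (k + j)%nat) [-] fst (u k)) <= 2 * snd (u k) - 2 * snd (u (k + j)%nat)).
    { intros k j. induction j as [|j IH].
      - rewrite Nat.add_0_r, rz_addN, nrm0. lra.
      - rewrite Nat.add_succ_r. destruct (Hu (k + j)%nat) as [_ [H1 [H2 _]]].
        apply Rle_trans with (1 := nrm_sub_triangle _ (fst (u (k + j)%nat)) _). lra. }
    destruct (bl_complete E (fun k => fst (u k))) as [y Hy].
    + intros eps He. destruct (pow2_small (4 * snd (u O)) eps He) as [N HN].
      exists N. intros n m Hn Hm.
      change (nrm (fst (u n) [-] fst (u m)) < eps).
      apply Rle_lt_trans with (1 := nrm_sub_triangle _ (fst (u N)) _).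
      assert (H1 := Hd N (n - N)%nat). assert (H2 := Hd N (m - N)%nat).
      replace (N + (n - N))%nat with n in H1 by lia.
      replace (N + (m - N))%nat with m in H2 by lia.
      rewrite <- nrm_opp in H2.
      replace ([-] (fst (u m) [-] fst (u N))) with (fst (u N) [-] fst (u m)) in H2 by vs.
      destruct (Hu n) as [Hn0 _], (Hu m) as [Hm0 _]. specialize (Hr N). lra.
    + assert (Hyk : forall k, nrm (y [-] fst (u k)) <= 2 * snd (u k)).
      { intros k. apply Rnot_lt_le. intros Hlt.
        destruct (Hy _ (proj2 (Rlt_0_minus _ _) Hlt)) as [N HN].
        specialize (HN (k + N)%nat). assert (H1 := Hd k N).
        assert (H2 : nrm (fst (u (k + N)%nat) [-] y) < nrm (y [-] fst (u k)) - 2 * snd (u k))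
          by (apply HN; lia).
        rewrite <- nrm_opp in H2.
        replace ([-] (fst (u (k + N)%nat) [-] y)) with (y [-] fst (u (k + N)%nat)) in H2 by vs.
        assert (H3 := nrm_sub_triangle y (fst (u (k + N)%nat)) (fst (u k))).
        destruct (Hu (k + N)%nat) as [H4 _]. lra. }
      destruct (Hpt y) as [B HB]. destruct (INR_unbounded B) as [k Hk].
      destruct (Hu k) as [_ [_ [_ [n Hn]]]].
      specialize (Hn y (Hyk (S k))). specialize (HB n). lra.
Qed.

End UniformBoundedness.

Section SlidingHump.
Context {E : BanachLattice}.
Implicit Types x y z v : bl_riesz E.
Hypothesis interpolation : sigma_interpolation E.

(** Interpolation yields [z1] between the even partial sums and [z] minus the odd ones. Then [z1]
    bounds the even subseries, z - z1 bounds the odd one, and one of the two has at most half the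
    [g]-mass of [z]. *)
Lemma halve (g : dual E) (u : nat -> bl_riesz E) z : rz0 [<=] g ->
  (forall i, rz0 [<=] u i) -> (forall K, vsum u K [<=] z) ->
  exists z1 (s : nat -> nat), z1 [<=] z /\
    (forall K, vsum (fun i => u (s i)) K [<=] z1) /\ g z1 <= g z / 2.
Proof.
  intros Hg Hu Hz.
  destruct (interpolation (fun K => vsum (fun i => u (2 * i)%nat) K)
              (fun K => z [-] vsum (fun i => u (2 * i + 1)%nat) K)) as [z1 Hz1].
  - intros K. repeat split.
    + change (vsum (fun i => u (2 * i)%nat) K [<=] vsum (fun i => u (2 * i)%nat) K [+] u (2 * K)%nat).
      apply (vle1 _ _ _ _ (Hu (2 * K)%nat)). vs.
    + assert (H := Hz (2 * S K)%nat). rewrite vsum_even_odd in H.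
      apply (vle1 _ _ _ _ H). vs.
    + change (z [-] (vsum (fun i => u (2 * i + 1)%nat) K [+] u (2 * K + 1)%nat) [<=]
              z [-] vsum (fun i => u (2 * i + 1)%nat) K).
      apply (vle1 _ _ _ _ (Hu (2 * K + 1)%nat)). vs.
  - assert (H1 : z1 [<=] z).
    { apply (vle1 _ _ _ _ (proj2 (Hz1 O))). simpl. vs. }
    assert (H0 : rz0 [<=] z1) by exact (proj1 (Hz1 O)).
    destruct (Rle_lt_dec (g z1) (g z / 2)) as [H|H].
    + exists z1, (fun i => (2 * i)%nat). repeat split; auto. intros K. apply Hz1.
    + exists (z [-] z1), (fun i => (2 * i + 1)%nat). repeat split.
      * apply (vle1 _ _ _ _ H0). vs.
      * intros K. apply (vle1 _ _ _ _ (proj2 (Hz1 K))). vs.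
      * rewrite dualB. lra.
Qed.

Lemma shrink (g : dual E) (u : nat -> bl_riesz E) z eps : 0 < eps -> rz0 [<=] g ->
  (forall i, rz0 [<=] u i) -> (forall K, vsum u K [<=] z) ->
  exists z1 (s : nat -> nat), z1 [<=] z /\
    (forall K, vsum (fun i => u (s i)) K [<=] z1) /\ g z1 < eps.
Proof.
  intros He Hg Hu Hz.
  assert (H : forall r, exists z1 (s : nat -> nat), z1 [<=] z /\
    (forall K, vsum (fun i => u (s i)) K [<=] z1) /\ g z1 <= g z * (/ 2) ^ r).
  { induction r as [|r IH].
    - exists z, (fun i => i). repeat split; auto using rz_le_refl. simpl; lra.
    - destruct IH as [z1 [s [H1 [H2 H3]]]].
      destruct (halve g (fun i => u (s i)) z1 Hg) as [z2 [t [H4 [H5 H6]]]]; auto.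
      exists z2, (fun i => s (t i)). repeat split; auto.
      + now apply rz_le_trans with z1.
      + simpl. lra. }
  destruct (pow2_small (g z) eps He) as [r Hr].
  destruct (H r) as [z1 [s [H1 [H2 H3]]]]. exists z1, s. repeat split; auto. lra.
Qed.

Lemma small_term (g : dual E) (u : nat -> bl_riesz E) z eps : 0 < eps -> rz0 [<=] g ->
  (forall K, vsum u K [<=] z) -> exists i, g (u i) < eps.
Proof.
  intros He Hg Hz. apply NNPP. intros Hn.
  assert (H : forall K, INR K * eps <= g (vsum u K)).
  { induction K as [|K IH]; [cbn [vsum INR]; rewrite dual0; lra|].
    rewrite S_INR. cbn [vsum]. rewrite dualD.
    assert (eps <= g (u K)); [|lra]. apply Rnot_lt_le. intros H. apply Hn. now exists K. }
  destruct (INR_unbounded (g z / eps)) as [K HK].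
  apply (Rmult_lt_compat_r eps) in HK; [|assumption].
  replace (g z / eps * eps) with (g z) in HK by (field; lra).
  assert (H1 := dual_mono g _ _ Hg (Hz K)). specialize (H K). lra.
Qed.

(** A state holds the sum [s] of the terms picked so far, a bound [z] for the partial sums of the
    terms still available, and the selection of those terms. The next term x is a hump of some [f m]
    that is small at [s] and whose absolute value is small at the new [z]. *)
Lemma no_hump (f : nat -> dual E) (w : nat -> bl_riesz E) (n : nat -> nat) v eps :
  (forall x, Un_cv (fun k => f k x) 0) -> 0 < eps ->
  (forall j, rz0 [<=] w j) -> (forall K, vsum w K [<=] v) ->
  (forall j, eps <= Rabs (f (n j) (w j))) -> False.
Proof.
  intros Hf He Hw Hv Hbig.
  destruct (dependent_choice (bl_riesz E * bl_riesz E * (nat -> nat))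
    (fun st => forall K, vsum (fun i => w (snd st i)) K [<=] snd (fst st))
    (fun j st st' => exists m x, rz0 [<=] x /\ fst (fst st') = fst (fst st) [+] x /\
       snd (fst st') [+] x [<=] snd (fst st) /\ (j <= m)%nat /\
       Rabs (f m (fst (fst st))) < eps / 4 /\ eps <= Rabs (f m x) /\
       vabs (f m) (snd (fst st')) < eps / 4)) as [st Hst].
  - exists (rz0, v, (fun i => i)). exact Hv.
  - intros j [[s z] sg] Hz. simpl in Hz.
    destruct (Hf s (eps / 4)) as [N HN]; [lra|].
    set (M := Nat.max j N).
    (* A term with [G]-mass below [eps] cannot be a hump of [f k] for k < M. Its index is therefore
       at least [M], where [f m] is already small at [s]. *)
    set (G := (vsum (fun k => vabs (f k : dual_riesz E)) M : dual E)).
    assert (HG0 : rz0 [<=] G) by (apply vsum_nonneg; intros; apply vabs_nonneg).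
    assert (HG : forall k x, (k < M)%nat -> rz0 [<=] x -> vabs (f k) x <= G x).
    { intros k x Hk Hx. unfold G. clear - Hk Hx. induction M as [|M IH]; [lia|].
      cbn [vsum]. set (T := (vsum (fun k => vabs (f k : dual_riesz E)) M : dual E)) in *.
      change (vabs (f k) x <= T x + vabs (f M) x).
      assert (HT : 0 <= T x).
      { apply dual_nonneg; auto. apply vsum_nonneg; intros; apply vabs_nonneg. }
      assert (HA : 0 <= vabs (f M) x) by (apply dual_nonneg; auto; apply vabs_nonneg).
      destruct (Nat.eq_dec k M) as [->|Hne]; [lra|].
      assert (vabs (f k) x <= T x) by (apply IH; lia). lra. }
    destruct (small_term G (fun i => w (sg i)) z eps He HG0 Hz) as [i Hi].
    set (m := n (sg i)). set (x := w (sg i)).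
    assert (Hm : (M <= m)%nat).
    { apply Nat.nlt_ge. intros Hlt.
      assert (H1 := HG m x Hlt (Hw _)). assert (H2 := dual_vabs (f m) x (Hw _)).
      assert (H3 := Hbig (sg i)). fold m x in H3. fold x in Hi. lra. }
    (* Terms up to position [i] are discarded, and the rest is thinned until everything that can
       still be added has [vabs (f m)]-mass below eps / 4. *)
    destruct (shrink (vabs (f m)) (fun l => w (sg (S i + l)%nat)) (z [-] x) (eps / 4))
      as [z1 [t [H1 [H2 H3]]]]; auto.
    + lra.
    + apply vabs_nonneg.
    + intros K. assert (H := Hz (S i + K)%nat).
      rewrite (vsum_split (fun i => w (sg i))) in H. cbn [vsum] in H. cbv beta in H.
      assert (H' : rz0 [<=] vsum (fun i0 => w (sg i0)) i) by (apply vsum_nonneg; auto).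
      apply (vle2 _ _ _ _ _ _ H H'). fold x. vs.
    + exists (s [+] x, z1, (fun l => sg (S i + t l)%nat)). split; [exact H2|].
      exists m, x. simpl. repeat split; auto.
      * apply Hw.
      * apply (vle1 _ _ _ _ H1). vs.
      * lia.
      * assert (H := HN m). unfold R_dist in H. rewrite Rminus_0_r in H. apply H. lia.
      * apply Hbig.
  - set (s := fun j => fst (fst (st j))). set (z := fun j => snd (fst (st j))).
    assert (Hz0 : forall j, rz0 [<=] z j) by (intros j; exact (proj1 (Hst j) O)).
    (* The element [y] replaces the infinite sum of the picked terms. At each hump, f_m(x) is f_m(y)
       minus f_m(s) minus f_m of the remainder, with absolute values below eps / 2, eps / 4 and eps
       / 4. *)
    destruct (interpolation s (fun j => s j [+] z j)) as [y Hy].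
    + intros j. destruct (Hst j) as [_ [m [x [Hx [H1 [H2 _]]]]]].
      fold (s j) (s (S j)) in H1. fold (z j) (z (S j)) in H2.
      change (s j [<=] s (S j) /\ s (S j) [<=] s (S j) [+] z (S j) /\
              s (S j) [+] z (S j) [<=] s j [+] z j).
      rewrite H1. repeat split.
      * apply (vle1 _ _ _ _ Hx). vs.
      * apply (vle1 _ _ _ _ (Hz0 (S j))). vs.
      * apply (vle1 _ _ _ _ H2). vs.
    + destruct (Hf y (eps / 2)) as [N HN]; [lra|].
      destruct (Hst N) as [_ [m [x [Hx [H1 [H2 [H3 [H4 [H5 H6]]]]]]]]].
      fold (s N) (s (S N)) in H1. fold (s N) in H4. fold (z (S N)) in H6.
      specialize (HN m H3). unfold R_dist in HN. rewrite Rminus_0_r in HN.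
      destruct (Hy (S N)) as [Hy1 Hy2].
      change (s (S N) [<=] y) in Hy1. change (y [<=] s (S N) [+] z (S N)) in Hy2.
      assert (H7 : Rabs (f m (y [-] s (S N))) <= vabs (f m) (z (S N))).
      { assert (Hp : rz0 [<=] y [-] s (S N)) by exact (proj1 (le_diff0 _ _) Hy1).
        apply Rle_trans with (1 := dual_vabs (f m) _ Hp).
        apply dual_mono; [apply vabs_nonneg|]. apply (vle1 _ _ _ _ Hy2). vs. }
      rewrite H1, dualB, dualD in H7.
      assert (H8 : f m x = f m y - f m (s N) - (f m y - (f m (s N) + f m x))) by ring.
      rewrite H8 in H5.
      assert (H9 := Rabs_triang (f m y - f m (s N)) (- (f m y - (f m (s N) + f m x)))).
      assert (H10 := Rabs_triang (f m y) (- f m (s N))).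
      rewrite Rabs_Ropp in H9, H10. unfold Rminus in *. lra.
Qed.

End SlidingHump.

Lemma nat_choice (X : Type) (Q : nat -> X -> Prop) :
  (forall n, exists x, Q n x) -> exists u : nat -> X, forall n, Q n (u n).
Proof.
  intros H. exists (fun n => proj1_sig (constructive_indefinite_description _ (H n))).
  intros n. apply proj2_sig.
Qed.

Lemma Rabs_le_inv a b : Rabs a <= b -> - b <= a <= b.
Proof.
  intros H. assert (G1 := Rle_abs a). assert (G2 := Rle_abs (- a)).
  rewrite Rabs_Ropp in G2. lra.
Qed.

Lemma Rabs_le_0 a : Rabs a <= 0 -> a = 0.
Proof. intros H. apply Rabs_le_inv in H. lra. Qed.

Lemma ulim_dual {E : BanachLattice} (g : nat -> dual E) C :
  (forall n, dual_bound E (g n) C) ->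
  exists f : dual E, forall x, ucv (fun n => g n x) (f x).
Proof.
  intros HC.
  assert (Hex : forall x : bl_riesz E, exists l, ucv (fun n => g n x) l).
  { intros x. apply ucv_ex with (C * nrm x). intros n. apply HC. }
  set (f := fun x => proj1_sig (constructive_indefinite_description _ (Hex x))).
  assert (Hf : forall x, ucv (fun n => g n x) (f x)).
  { intros x. apply (proj2_sig (constructive_indefinite_description _ (Hex x))). }
  assert (Hin : in_dual E f).
  { split; [split|].
    - intros x y. change (f (x [+] y) = f x + f y).
      apply ucv_unique with (fun n => g n (x [+] y)); [apply Hf|].
      assert (H := ucv_add _ _ _ _ (Hf x) (Hf y)).
      intros eps He. apply FU_mono with (2 := H eps He). intros n. now rewrite dualD.
    - intros a x. change (f (a [*] x) = a * f x).
      apply ucv_unique with (fun n => g n (a [*] x)); [apply Hf|].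
      assert (H := ucv_scal _ _ a (Hf x)).
      intros eps He. apply FU_mono with (2 := H eps He). intros n. now rewrite dualZ.
    - exists C. intros x. apply Rabs_le. split.
      + apply (ucv_le (fun _ => - (C * bl_norm x)) (fun n => g n x)); [|apply ucv_const|apply Hf].
        apply FU_all. intros n. assert (H := HC n x). apply Rabs_le_inv in H. apply H.
      + apply (ucv_le (fun n => g n x) (fun _ => C * bl_norm x)); [|apply Hf|apply ucv_const].
        apply FU_all. intros n. assert (H := HC n x). apply Rabs_le_inv in H. apply H. }
  exists (MkDual f Hin). exact Hf.
Qed.

(** * Small midpoint combinations in an order interval of the dual *)

(** Cauchy-Schwarz; for positive [u] and [v] the difference of the sides is (p v - q u)^2 / (u v (u
    + v)). A vanishing denominator forces its numerator to vanish. *)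
Lemma sq_div_superadd p q u v : Rabs p <= u -> Rabs q <= v ->
  (p + q) ^ 2 / (u + v) <= p ^ 2 / u + q ^ 2 / v.
Proof.
  intros Hp Hq. assert (H1 := Rabs_pos p). assert (H2 := Rabs_pos q).
  destruct (Req_dec u 0) as [->|Hu].
  { assert (p = 0) by (apply Rabs_le_0; lra). subst p. rewrite !Rplus_0_l.
    unfold Rdiv. rewrite pow_i by lia. lra. }
  destruct (Req_dec v 0) as [->|Hv].
  { assert (q = 0) by (apply Rabs_le_0; lra). subst q. rewrite !Rplus_0_r.
    unfold Rdiv. rewrite (pow_i 2) by lia. lra. }
  assert (0 < u) by lra. assert (0 < v) by lra.
  replace (p ^ 2 / u + q ^ 2 / v) with ((p + q) ^ 2 / (u + v) + (p * v - q * u) ^ 2 / (u * v * (u + v)))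
    by (field; lra).
  assert (0 <= (p * v - q * u) ^ 2 / (u * v * (u + v))); [|lra].
  apply Rmult_le_pos; [apply pow2_ge_0|]. left. apply Rinv_0_lt_compat.
  repeat apply Rmult_lt_0_compat; lra.
Qed.

Lemma sq_div_le p u : Rabs p <= u -> p ^ 2 / u <= u.
Proof.
  intros Hp. assert (H1 := Rabs_pos p).
  destruct (Req_dec u 0) as [->|Hu].
  { assert (p = 0) by (apply Rabs_le_0; lra). subst p. unfold Rdiv. rewrite pow_i by lia. lra. }
  apply Rmult_le_reg_r with u; [lra|]. unfold Rdiv. rewrite Rmult_assoc, Rinv_l, Rmult_1_r by lra.
  rewrite <- (pow2_abs p). nra.
Qed.

Lemma sq_div_nonneg p u : 0 <= u -> 0 <= p ^ 2 / u.
Proof.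
  intros [Hu|<-].
  - apply Rmult_le_pos; [apply pow2_ge_0|]. left. now apply Rinv_0_lt_compat.
  - unfold Rdiv. rewrite Rinv_0. lra.
Qed.

Section MidpointHull.
Context {E : BanachLattice}.
Implicit Types x y z : bl_riesz E.
Implicit Types c k : dual E.

(** Midpoints are the only convex combinations that the parallelogram law requires. The index set
    [A] allows restriction to smaller sets of the ultrafilter. *)
Inductive midhull (d : nat -> dual E) (A : nat -> Prop) : dual E -> Prop :=
  | midhull_base n : A n -> midhull d A (d n)
  | midhull_mid c k : midhull d A c -> midhull d A k -> midhull d A (/ 2 [*] (c [+] k)).

Definition dominated (H c : dual E) : Prop := c [<=] H /\ [-] c [<=] H.

Variable H : dual E.

(* [energy c P] is the squared L^2 norm of the conditional expectation of the
   density of [c] with respect to [H], given the partition [P]; a junk quotient by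
   zero occurs only where the numerator vanishes too. *)
Fixpoint energy (c : dual E) (P : list (bl_riesz E)) : R :=
  match P with
  | nil => 0
  | y :: P => c y ^ 2 / H y + energy c P
  end.

Definition partition (x : bl_riesz E) (P : list (bl_riesz E)) : Prop :=
  Forall (fun y => rz0 [<=] y) P /\ lsum P = x.

Hypothesis H_pos : rz0 [<=] H.

Lemma dominated_abs c x : dominated H c -> rz0 [<=] x -> Rabs (c x) <= H x.
Proof. intros [H1 H2]. now apply dual_abs_le. Qed.

Lemma dominated_comb a b c k : Rabs a + Rabs b <= 1 -> dominated H c -> dominated H k ->
  dominated H (a [*] c [+] b [*] k).
Proof.
  intros Hab Hc Hk.
  assert (G : forall x, rz0 [<=] x -> Rabs (a * c x + b * k x) <= H x).
  { intros x Hx. apply Rle_trans with (1 := Rabs_triang _ _). rewrite !Rabs_mult.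
    assert (H1 := dominated_abs c x Hc Hx). assert (H2 := dominated_abs k x Hk Hx).
    assert (H3 := Rabs_pos a). assert (H4 := Rabs_pos b).
    assert (H5 := Rabs_pos (c x)). assert (H6 := Rabs_pos (k x)). nra. }
  split; intros x Hx; assert (G1 := G x Hx); apply Rabs_le_inv in G1.
  - change (a * c x + b * k x <= H x). lra.
  - change (- (a * c x + b * k x) <= H x). lra.
Qed.

Lemma midhull_dominated d A c : (forall n, dominated H (d n)) -> midhull d A c -> dominated H c.
Proof.
  intros Hd. induction 1 as [n Hn|c k _ IH1 _ IH2]; [apply Hd|].
  replace (/ 2 [*] (c [+] k)) with (/ 2 [*] c [+] / 2 [*] k) by vs.
  apply dominated_comb; auto. rewrite Rabs_pos_eq; lra.
Qed.

Lemma midhull_mono d (A B : nat -> Prop) c : (forall n, A n -> B n) -> midhull d A c -> midhull d B c.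
Proof. intros HAB. induction 1; constructor; auto. Qed.

Lemma midhull_abs (d : nat -> dual E) (A : nat -> Prop) c x eta : (forall n, A n -> Rabs (d n x) <= eta) ->
  midhull d A c -> Rabs (c x) <= eta.
Proof.
  intros HA. induction 1 as [n Hn|c k _ IH1 _ IH2]; [now apply HA|].
  change (Rabs (/ 2 * (c x + k x)) <= eta). apply Rabs_le_inv in IH1, IH2.
  apply Rabs_le. lra.
Qed.

Lemma energy_superadd c x y : dominated H c -> rz0 [<=] x -> rz0 [<=] y ->
  c (x [+] y) ^ 2 / H (x [+] y) <= c x ^ 2 / H x + c y ^ 2 / H y.
Proof.
  intros Hc Hx Hy. rewrite !dualD. apply sq_div_superadd; now apply dominated_abs.
Qed.

Lemma energy_nonneg c P : Forall (fun y => rz0 [<=] y) P -> 0 <= energy c P.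
Proof.
  induction 1 as [|y P Hy HP IH]; simpl; [lra|].
  assert (0 <= c y ^ 2 / H y) by (apply sq_div_nonneg; now apply dual_nonneg). simpl in *. lra.
Qed.

Lemma energy_le c P : dominated H c -> Forall (fun y => rz0 [<=] y) P -> energy c P <= H (lsum P).
Proof.
  intros Hc. induction 1 as [|y P Hy HP IH]; cbn [energy lsum].
  - rewrite dual0; lra.
  - rewrite dualD. assert (G := sq_div_le (c y) (H y) (dominated_abs c y Hc Hy)). lra.
Qed.

Lemma energy_parallelogram c k P :
  energy (/ 2 [*] (c [+] k)) P + energy (/ 2 [*] (c [-] k)) P = (energy c P + energy k P) / 2.
Proof.
  induction P as [|y P IH]; cbn [energy]; [lra|].
  change ((/ 2 [*] (c [+] k)) y) with (/ 2 * (c y + k y)).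
  change ((/ 2 [*] (c [-] k)) y) with (/ 2 * (c y + - k y)).
  unfold Rdiv in *. lra.
Qed.

(** Riesz decomposition spreads [x] over the cells and cuts each cell in two, so that [x] is a sum
    of cells of [Q]. Superadditivity of the quotients then gives both estimates. *)
Lemma partition_refine P x : Forall (fun y => rz0 [<=] y) P -> rz0 [<=] x -> x [<=] lsum P ->
  exists Q, partition (lsum P) Q /\
    (forall c, dominated H c -> energy c P <= energy c Q) /\
    (forall c, dominated H c -> c x ^ 2 / H x <= energy c Q).
Proof.
  intros HP. revert x. induction HP as [|y P Hy HP IH]; intros x Hx Hxt.
  - exists nil. cbn [lsum energy] in *. repeat split; [constructor|intros; lra|].
    intros c Hc. replace x with (rz0 : bl_riesz E) by now apply rz_le_antisym.
    rewrite !dual0. unfold Rdiv. rewrite pow_i by lia. lra.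
  - cbn [lsum] in Hxt.
    assert (HP0 : rz0 [<=] lsum P).
    { clear - HP. induction HP; cbn [lsum]; [apply rz_le_refl|now apply add_nonneg]. }
    destruct (riesz_decomp x y (lsum P)) as [x1 [x2 [H1 [H2 [H3 [H4 ->]]]]]]; auto.
    destruct (IH x2 H2 H4) as [Q [[HQ1 HQ2] [HQ3 HQ4]]].
    assert (H5 : rz0 [<=] y [-] x1) by exact (proj1 (le_diff0 _ _) H3).
    exists (x1 :: y [-] x1 :: Q). repeat split.
    + repeat constructor; auto.
    + cbn [lsum]. rewrite HQ2. vs.
    + intros c Hc. cbn [energy]. specialize (HQ3 c Hc).
      assert (G := energy_superadd c x1 (y [-] x1) Hc H1 H5).
      replace (x1 [+] (y [-] x1)) with y in G by vs. lra.
    + intros c Hc. cbn [energy]. specialize (HQ4 c Hc).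
      assert (G := energy_superadd c x1 x2 Hc H1 H2).
      assert (G2 := sq_div_nonneg (c (y [-] x1)) _ (dual_nonneg _ _ H_pos H5)). lra.
Qed.

Variable d : nat -> dual E.
Hypothesis d_dom : forall n, dominated H (d n).
Hypothesis d_lim : forall x, ucv (fun n => d n x) 0.

(* Near-minimizers of the energy over smaller and smaller sets of the ultrafilter
   are close to each other by the parallelogram law. *)
Lemma midhull_small_on_interval x0 delta : rz0 [<=] x0 -> 0 < delta ->
  exists c, midhull d (fun _ => True) c /\
    forall x, rz0 [<=] x -> x [<=] x0 -> Rabs (c x) <= delta.
Proof.
  intros Hx0 Hdelta.
  (* The supremum [I] of [Z] is the supremum, over ultrafilter sets [A], of the least total energy
     on the hull of [A]; total energy is itself a supremum over partitions. *)
  set (Z := fun t => exists A, FU A /\ forall c, midhull d A c ->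
              exists P, partition x0 P /\ t <= energy c P).
  assert (HA : forall A, FU A -> exists c, midhull d A c).
  { intros A H1. destruct (FU_ex _ H1) as [n Hn]. exists (d n). now constructor. }
  destruct (completeness Z) as [I [HI1 HI2]].
  - exists (H x0). intros t [A [H1 H2]]. destruct (HA A H1) as [c Hc].
    destruct (H2 c Hc) as [P [[HP1 HP2] HP3]]. rewrite <- HP2.
    apply Rle_trans with (1 := HP3). apply energy_le; auto. now apply midhull_dominated with d A.
  - exists 0, (fun _ => True). split; [now apply FU_all|]. intros c Hc.
    exists [x0]. split.
    + split; [repeat constructor; assumption|]. cbn [lsum]. vs.
    + apply energy_nonneg. repeat constructor; assumption.
  - assert (Hh := dual_nonneg _ _ H_pos Hx0). set (h0 := H x0) in *.
    (* The half difference of two near-minimizers will have energy below 2 eta; times H x <= h0 this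
       is at most (delta / 4)^2. *)
    set (eta := (delta / 4) ^ 2 / (2 * (h0 + 1))).
    assert (Heta : 0 < eta).
    { apply Rdiv_lt_0_compat; [apply pow_lt|]; lra. }
    assert (Heta2 : 2 * eta * (h0 + 1) = (delta / 4) ^ 2) by (unfold eta; field; lra).
    assert (HZ1 : exists t, Z t /\ I - eta < t).
    { apply NNPP. intros Hn. assert (I <= I - eta); [|lra]. apply HI2.
      intros t Ht. apply Rnot_lt_le. intros Hlt. apply Hn. now exists t. }
    assert (HZ2 : forall A, FU A -> exists c, midhull d A c /\
              forall P, partition x0 P -> energy c P < I + eta).
    { intros A HFA. apply NNPP. intros Hn. assert (I + eta <= I); [|lra].
      apply HI1. exists A. split; [assumption|]. intros c Hc.
      apply NNPP. intros Hn2. apply Hn. exists c. split; [assumption|].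
      intros P HP. apply Rnot_le_lt. intros Hle. apply Hn2. now exists P. }
    destruct HZ1 as [t [[A0 [HA0 HA0']] Ht]].
    destruct (HZ2 A0 HA0) as [c [Hc Hcen]].
    exists c. split; [now apply midhull_mono with A0|].
    intros x Hx Hxx0.
    (* The combination [c] is fixed before [x]. Only the companion [k] depends on [x]: it comes from
       indices where [d n x] is small, and closeness to [k] makes [c x] small. *)
    assert (HFA' := d_lim x (delta / 2) ltac:(lra)).
    destruct (HZ2 _ (FU_and _ _ HA0 HFA')) as [k [Hk Hken]].
    assert (Hk' : midhull d A0 k) by (apply midhull_mono with (2 := Hk); tauto).
    assert (Hkx : Rabs (k x) <= delta / 2).
    { apply midhull_abs with (2 := Hk). intros n [_ Hn]. rewrite Rminus_0_r in Hn. lra. }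
    destruct (HA0' _ (midhull_mid _ _ _ _ Hc Hk')) as [P [[HP1 HP2] HP3]].
    destruct (partition_refine P x HP1 Hx) as [Q [HQ1 [HQ2 HQ3]]]; [now rewrite HP2|].
    rewrite HP2 in HQ1.
    assert (Dc := midhull_dominated d A0 c d_dom Hc).
    assert (Dk := midhull_dominated d A0 k d_dom Hk').
    assert (Dm := midhull_dominated d A0 _ d_dom (midhull_mid _ _ _ _ Hc Hk')).
    assert (Dd : dominated H (/ 2 [*] (c [-] k))).
    { replace (/ 2 [*] (c [-] k)) with (/ 2 [*] c [+] (- / 2) [*] k) by vs.
      apply dominated_comb; auto. rewrite Rabs_Ropp, Rabs_pos_eq; lra. }
    assert (E1 := energy_parallelogram c k Q).
    assert (E2 := Hcen Q HQ1). assert (E3 := Hken Q HQ1).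
    assert (E4 := HQ2 _ Dm). assert (E5 := HQ3 _ Dd).
    assert (E6 := dominated_abs _ _ Dd Hx).
    change ((/ 2 [*] (c [-] k)) x) with (/ 2 * (c x + - k x)) in E5, E6.
    set (q := / 2 * (c x + - k x)) in *.
    assert (Hhx : 0 <= H x <= h0).
    { split; [now apply dual_nonneg|now apply dual_mono]. }
    assert (Hq : q ^ 2 <= (delta / 4) ^ 2).
    { rewrite <- Heta2. destruct (Req_dec (H x) 0) as [Hz|Hz].
      - rewrite Hz in E6. assert (q = 0) as -> by (apply Rabs_le_0; pose proof (Rabs_pos q); lra).
        rewrite pow_i by lia. nra.
      - assert (E7 : q ^ 2 / H x <= 2 * eta) by lra.
        apply (Rmult_le_compat_r (H x)) in E7; [|lra].
        unfold Rdiv in E7. rewrite Rmult_assoc, Rinv_l, Rmult_1_r in E7 by assumption. nra. }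
    assert (Hq2 : Rabs q <= delta / 4).
    { apply Rabs_le. split; nra. }
    replace (c x) with (2 * q + k x) by (unfold q; field).
    apply Rle_trans with (1 := Rabs_triang _ _). rewrite Rabs_mult, (Rabs_pos_eq 2) by lra. lra.
Qed.

Lemma vabs_dual_le c x r : rz0 [<=] x ->
  (forall y, rz0 [<=] y -> y [<=] x -> Rabs (c y) <= r) -> vabs c x <= 2 * r.
Proof.
  intros Hx Hr. rewrite vabsE. change (vpos c x + vpos ([-] c) x <= 2 * r).
  assert (vpos c x <= r).
  { apply vpos_dual_le; [assumption|]. intros y H1 H2.
    apply Rle_trans with (1 := Rle_abs _). now apply Hr. }
  assert (vpos ([-] c) x <= r).
  { apply vpos_dual_le; [assumption|]. intros y H1 H2.
    change (- c y <= r). apply Rle_trans with (1 := Rle_abs _). rewrite Rabs_Ropp. now apply Hr. }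
  lra.
Qed.

Hypothesis order_cont : dual_order_continuous E.

(** If every combination exceeded [eps] in norm, there would be c_n and z_n with |c_n|(|z_n|) > eps
    ||z_n|| and |c_n|(|z_i|) <= 2^(-n) for i < n. The suprema s_m of |c_j| over j >= m decrease to
    some [t] that vanishes on every |z_i|. Order continuity makes some s_m - t smaller than [eps] in
    norm, which fails at z_m. *)
Lemma midhull_small_norm eps : 0 < eps ->
  exists c, midhull d (fun _ => True) c /\ dual_bound E c eps.
Proof.
  intros He. apply NNPP. intros Hno.
  assert (Hz : forall c, midhull d (fun _ => True) c -> exists z, eps * nrm z < Rabs (c z)).
  { intros c Hc. apply NNPP. intros Hn. apply Hno. exists c. split; [assumption|].
    intros z. apply Rnot_lt_le. intros Hlt. apply Hn. now exists z. }
  destruct (dependent_choice (bl_riesz E) (fun x => rz0 [<=] x)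
    (fun n x x' => exists cz : dual E * bl_riesz E, dominated H (fst cz) /\
       x' = x [+] vabs (snd cz) /\ eps * nrm (snd cz) < Rabs (fst cz (snd cz)) /\
       vabs (fst cz) x <= (/ 2) ^ n)) as [xs Hxs].
  - exists rz0. apply rz_le_refl.
  - intros n x Hx.
    destruct (midhull_small_on_interval x ((/ 2) ^ S n) Hx) as [c [Hc1 Hc2]];
      [apply pow_lt; lra|].
    destruct (Hz c Hc1) as [z Hz1].
    exists (x [+] vabs z). split; [apply add_nonneg; auto using vabs_nonneg|].
    exists (c, z). cbn [fst snd]. repeat split; auto;
      try apply (midhull_dominated d (fun _ => True) c d_dom Hc1).
    replace ((/ 2) ^ n) with (2 * (/ 2) ^ S n) by (simpl; field). now apply vabs_dual_le.
  - destruct (nat_choice _ _ (fun n => proj2 (Hxs n))) as [cz Hcz].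
    set (c := fun n => fst (cz n)). set (z := fun n => snd (cz n)).
    assert (Hxs_mono : forall n m, xs n [<=] xs (n + m)%nat).
    { intros n m. induction m as [|m IH]; [rewrite Nat.add_0_r; apply rz_le_refl|].
      rewrite Nat.add_succ_r. destruct (Hcz (n + m)%nat) as [_ [-> _]].
      apply (vle2 _ _ _ _ _ _ IH (vabs_nonneg (snd (cz (n + m)%nat)))). vs. }
    assert (Hzx : forall i n, (i < n)%nat -> vabs (z i) [<=] xs n).
    { intros i n Hin. apply rz_le_trans with (xs (S i)).
      - destruct (Hcz i) as [_ [-> _]]. apply (vle1 _ _ _ _ (proj1 (Hxs i))). unfold z. vs.
      - replace n with (S i + (n - S i))%nat by lia. apply Hxs_mono. }
    assert (Hcz_small : forall i n, (i < n)%nat -> vabs (c n) (vabs (z i)) <= (/ 2) ^ n).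
    { intros i n Hin. destruct (Hcz n) as [_ [_ [_ Hs]]].
      apply Rle_trans with (2 := Hs). apply dual_mono; [apply vabs_nonneg|now apply Hzx]. }
    assert (Hcz_big : forall n, eps * nrm (z n) < vabs (c n) (vabs (z n))).
    { intros n. destruct (Hcz n) as [_ [_ [Hb _]]].
      apply Rlt_le_trans with (1 := Hb). apply dual_vabs_vabs. }
    (* The finite joins of |c_m|, ..., |c_(m+N)|. They increase in [N] below [H], so their pointwise
       limit is the supremum s_m. *)
    set (J := fix J m N : dual E := match N with
                | O => vabs (c m)
                | S N => join (J m N) (vabs (c (m + S N)%nat)) end).
    assert (HJ0 : forall m N, rz0 [<=] J m N).
    { intros m N. destruct N as [|N]; cbn [J]; [apply vabs_nonneg|].
      apply rz_le_trans with (2 := join_r _ _). apply vabs_nonneg. }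
    assert (HcH : forall n, vabs (c n) [<=] H).
    { intros n. destruct (Hcz n) as [[H1 H2] _]. now apply vabs_le. }
    assert (HJH : forall m N, J m N [<=] H).
    { intros m N. induction N as [|N IH]; cbn [J]; [apply HcH|]. apply join_lub; auto. }
    assert (HJmono : forall m N K, J m N [<=] J m (N + K)%nat).
    { intros m N K. induction K as [|K IH]; [rewrite Nat.add_0_r; apply rz_le_refl|].
      rewrite Nat.add_succ_r. cbn [J]. apply rz_le_trans with (1 := IH). apply join_l. }
    assert (HJS : forall m N, J (S m) N [<=] J m (S N)).
    { intros m N. induction N as [|N IH]; cbn [J] in *.
      - replace (S m) with (m + 1)%nat by lia. apply join_r.
      - apply join_lub.
        + apply rz_le_trans with (1 := IH). apply join_l.
        + replace (S m + S N)%nat with (m + S (S N))%nat by lia. apply join_r. }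
    (* Bounding the join by the sum leaves the geometric sum of 2^(-j) for m <= j <= m + N, written
       in closed form. *)
    assert (HJsmall : forall m N i, (i < m)%nat ->
              J m N (vabs (z i)) <= 2 * (/ 2) ^ m - (/ 2) ^ (m + N)).
    { intros m N i Him. induction N as [|N IH].
      - rewrite Nat.add_0_r. cbn [J]. assert (G := Hcz_small i m Him). lra.
      - cbn [J].
        assert (G := Hcz_small i (m + S N)%nat ltac:(lia)).
        assert (G2 : join (J m N) (vabs (c (m + S N)%nat)) [<=] J m N [+] vabs (c (m + S N)%nat)).
        { apply join_lub.
          - apply (vle1 _ _ _ _ (vabs_nonneg (c (m + S N)%nat : dual_riesz E))). vs.
          - apply (vle1 _ _ _ _ (HJ0 m N)). vs. }
        assert (G3 := dle_app _ _ _ G2 (vabs_nonneg (z i))).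
        change ((J m N [+] vabs (c (m + S N)%nat)) (vabs (z i)))
          with (J m N (vabs (z i)) + vabs (c (m + S N)%nat) (vabs (z i))) in G3.
        rewrite Nat.add_succ_r in *. cbn [pow] in *. lra. }
    destruct (dual_bound_nonneg H) as [CH [HCH HHb]].
    assert (Hs : forall m, exists s : dual E, forall x, ucv (fun N => J m N x) (s x)).
    { intros m. apply ulim_dual with CH. intros N. apply dual_bound_mono with H; auto. }
    destruct (nat_choice _ _ Hs) as [s Hsl].
    assert (HJs : forall m N, J m N [<=] s m).
    { intros m N x Hx. apply (ucv_le (fun _ => J m N x) (fun K => J m K x)); [|apply ucv_const|apply Hsl].
      apply FU_mono with (2 := FU_tail N). intros K HK.
      replace K with (N + (K - N))%nat by lia. now apply dle_app. }
    assert (Hs_le : forall m h, (forall N, J m N [<=] h) -> s m [<=] h).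
    { intros m h Hh x Hx. apply (ucv_le (fun K => J m K x) (fun _ => h x)); [|apply Hsl|apply ucv_const].
      apply FU_all. intros K. now apply dle_app. }
    assert (HsS : forall m, s (S m) [<=] s m).
    { intros m. apply Hs_le. intros N. apply rz_le_trans with (1 := HJS m N). apply HJs. }
    assert (Hs_mono : forall m K, s (m + K)%nat [<=] s m).
    { intros m K. induction K as [|K IH]; [rewrite Nat.add_0_r; apply rz_le_refl|].
      rewrite Nat.add_succ_r. apply rz_le_trans with (1 := HsS _). assumption. }
    assert (Hs0 : forall m, rz0 [<=] s m).
    { intros m. apply rz_le_trans with (1 := HJ0 m O). apply HJs. }
    destruct (ulim_dual s CH) as [t Ht].
    { intros m. apply dual_bound_mono with H; auto. }
    assert (Hts : forall m, t [<=] s m).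
    { intros m x Hx. apply (ucv_le (fun K => s K x) (fun _ => s m x)); [|apply Ht|apply ucv_const].
      apply FU_mono with (2 := FU_tail m). intros K HK.
      replace K with (m + (K - m))%nat by lia. now apply dle_app. }
    assert (Htz : forall i, t (vabs (z i)) <= 0).
    { intros i. apply Rnot_lt_le. intros Hlt.
      destruct (pow2_small 2 _ Hlt) as [m Hm].
      set (m' := (S i + m)%nat).
      assert (G1 := dle_app _ _ _ (Hts m') (vabs_nonneg (z i))).
      assert (G2 : s m' (vabs (z i)) <= 2 * (/ 2) ^ m').
      { apply (ucv_le (fun K => J m' K (vabs (z i))) (fun _ => 2 * (/ 2) ^ m'));
          [|apply Hsl|apply ucv_const].
        apply FU_all. intros K. assert (G := HJsmall m' K i ltac:(unfold m'; lia)).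
        assert (0 < (/ 2) ^ (m' + K)) by (apply pow_lt; lra). lra. }
      assert (G3 : (/ 2) ^ m' <= (/ 2) ^ m).
      { unfold m'. rewrite pow_add. assert (0 < (/ 2) ^ m) by (apply pow_lt; lra).
        assert ((/ 2) ^ S i <= 1).
        { rewrite <- (pow1 (S i)). apply pow_incr. lra. }
        nra. }
      lra. }
    destruct (order_cont (fun g => exists m, g = (s m [-] t : dual E))) with (eps := eps)
      as [g [[m ->] [b [Hb1 [Hb2 Hb3]]]]].
    + intros g [m ->]. apply dualP.
    + exists (s O [-] t : dual E). now exists O.
    + intros g1 g2 [m1 ->] [m2 ->]. exists (s (m1 + m2)%nat [-] t : dual E). repeat split.
      * now exists (m1 + m2)%nat.
      * assert (G : s (m1 + m2)%nat [-] t [<=] s m1 [-] t).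
        { apply (vle1 _ _ _ _ (Hs_mono m1 m2)). vs. }
        exact G.
      * rewrite Nat.add_comm. assert (G : s (m2 + m1)%nat [-] t [<=] s m2 [-] t).
        { apply (vle1 _ _ _ _ (Hs_mono m2 m1)). vs. }
        exact G.
    + split; [apply in_dual_zero|]. split.
      * intros g [m ->]. assert (G : rz0 [<=] s m [-] t) by exact (proj1 (le_diff0 _ _) (Hts m)).
        exact G.
      * intros k Hk1 Hk2 x Hx. apply Rnot_lt_le. intros Hlt.
        destruct (FU_ex _ (Ht x _ Hlt)) as [m Hm].
        assert (G := Hk2 _ (ex_intro _ m eq_refl) x Hx).
        change (k x <= s m x + - t x) in G. apply Rabs_def2 in Hm. lra.
    + assumption.
    + assert (G1 := dual_bound_app (s m [-] t : dual E) b (vabs (z m)) Hb3).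
      change (s m (vabs (z m)) + - t (vabs (z m)) <= b * nrm (vabs (z m))) in G1.
      assert (G2 := dle_app _ _ _ (HJs m O) (vabs_nonneg (z m))). cbn [J] in G2.
      assert (G3 := Hcz_big m). specialize (Htz m). rewrite nrm_vabs in G1.
      assert (G4 := nrm_nonneg (z m)). nra.
Qed.

End MidpointHull.

(** * Disjoint sequences extracted from rows of disjoint functionals *)

Fixpoint rsum (g : nat -> R) (l : list nat) : R :=
  match l with nil => 0 | k :: l => g k + rsum g l end.

Lemma lsum_nonneg {V : Riesz} (w : nat -> V) l : (forall k, In k l -> rz0 [<=] w k) ->
  rz0 [<=] lsum (map w l).
Proof.
  induction l as [|k l IH]; intros Hw; cbn [map lsum]; [apply rz_le_refl|].
  apply add_nonneg; [apply Hw; now left|]. apply IH. intros i Hi. apply Hw. now right.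
Qed.

Lemma rsum_le (g h : nat -> R) l : (forall k, In k l -> g k <= h k) -> rsum g l <= rsum h l.
Proof.
  induction l as [|k l IH]; intros H; simpl; [lra|].
  assert (g k <= h k) by (apply H; now left).
  assert (rsum g l <= rsum h l) by (apply IH; intros; apply H; now right). lra.
Qed.

Lemma rsum_const c l : rsum (fun _ => c) l = INR (length l) * c.
Proof.
  induction l as [|k l IH]; [simpl; ring|]. cbn [rsum length]. rewrite S_INR, IH. ring.
Qed.

Lemma rsum_filter_le (g : nat -> R) (b : nat -> bool) (C t : R) l :
  (forall k, In k l -> g k <= C) -> (forall k, In k l -> b k = false -> g k <= t) -> 0 <= t ->
  rsum g l <= INR (length (filter b l)) * C + INR (length l) * t.
Proof.
  intros HC Ht Ht0. induction l as [|k l IH]; [simpl; lra|].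
  cbn [rsum filter]. cbn [length]. rewrite S_INR.
  assert (G : rsum g l <= INR (length (filter b l)) * C + INR (length l) * t).
  { apply IH; intros; [apply HC|apply Ht]; auto; now right. }
  destruct (b k) eqn:Hb; cbn [length].
  - rewrite S_INR. assert (g k <= C) by (apply HC; now left). lra.
  - assert (g k <= t) by (apply Ht; auto; now left). lra.
Qed.

Lemma lsum_app {E : BanachLattice} (g : nat -> dual E) l x :
  (lsum (map g l) : dual E) x = rsum (fun k => g k x) l.
Proof.
  induction l as [|k l IH]; cbn [map lsum rsum]; [reflexivity|].
  rewrite <- IH. reflexivity.
Qed.

Lemma disjoint_lsum {V : Riesz} (w : nat -> V) l x : rz0 [<=] x ->
  (forall k, In k l -> rz0 [<=] w k) -> (forall k, In k l -> disjoint x (w k)) ->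
  disjoint x (lsum (map w l)).
Proof.
  intros Hx. induction l as [|k l IH]; intros H0 H; cbn [map lsum].
  - apply disjoint_of_le; auto using rz_le_refl. apply meet_r.
  - apply disjoint_add; auto.
    + apply H0; now left.
    + apply lsum_nonneg. intros; apply H0; now right.
    + apply H; now left.
    + apply IH; intros; [apply H0|apply H]; now right.
Qed.

Section DisjointExtraction.
Context {E : BanachLattice}.
Implicit Types x y z u v w : bl_riesz E.

(** The first functional is disjoint from the sum of the others, so [disjoint_split] gives it a
    piece [w] of [v] on which the others are small. The recursion continues inside v - w, with the
    error budget halved. *)
Lemma split_list (h : nat -> dual E) l : NoDup l -> (forall k, In k l -> rz0 [<=] h k) ->
  (forall i k, In i l -> In k l -> i <> k -> disjoint (h i) (h k)) ->
  forall v eta, rz0 [<=] v -> 0 < eta ->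
  exists ws : nat -> bl_riesz E,
    (forall k, In k l -> rz0 [<=] ws k /\ ws k [<=] v /\ h k (v [-] ws k) <= eta) /\
    lsum (map ws l) [<=] v.
Proof.
  induction 1 as [|k l Hk Hl IH]; intros H0 Hd v eta Hv Heta.
  - exists (fun _ => rz0). split; [intros k []|assumption].
  - assert (H0k : rz0 [<=] h k) by (apply H0; now left).
    assert (H0l : forall i, In i l -> rz0 [<=] h i) by (intros; apply H0; now right).
    assert (Hdk : disjoint (h k : dual_riesz E) (lsum (map h l))).
    { apply disjoint_lsum; auto. intros i Hi. apply Hd; [now left|now right|congruence]. }
    destruct (disjoint_split _ _ v (eta / 2) Hdk Hv) as [w [Hw1 [Hw2 Hw3]]]; [lra|].
    assert (Hv' : rz0 [<=] v [-] w) by exact (proj1 (le_diff0 _ _) Hw2).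
    destruct (IH H0l) with (v := v [-] w) (eta := eta / 2) as [ws [Hws1 Hws2]]; auto; [|lra|].
    { intros i j Hi Hj. apply Hd; now right. }
    assert (HS : 0 <= (lsum (map h l) : dual E) w) by (apply dual_nonneg; auto using lsum_nonneg).
    exists (fun i => if Nat.eq_dec i k then w else ws i). split.
    + intros i Hi. destruct (Nat.eq_dec i k) as [->|Hne].
      * repeat split; auto. lra.
      * destruct Hi as [Hi|Hi]; [congruence|]. destruct (Hws1 i Hi) as [G1 [G2 G3]].
        repeat split; auto.
        -- apply (vle2 _ _ _ _ _ _ G2 Hw1). vs.
        -- replace (v [-] ws i) with ((v [-] w [-] ws i) [+] w) by vs. rewrite dualD.
           assert (h i w <= (lsum (map h l) : dual E) w).
           { rewrite lsum_app. clear - H0l Hi Hw1. induction l as [|j l IH]; [destruct Hi|].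
             cbn [rsum].
             assert (G : forall l', (forall i, In i l' -> rz0 [<=] h i) -> 0 <= rsum (fun k => h k w) l').
             { intros l' Hl'. rewrite <- lsum_app. apply dual_nonneg; auto using lsum_nonneg. }
             destruct Hi as [->|Hi].
             - assert (0 <= rsum (fun k => h k w) l) by (apply G; intros; apply H0l; now right). lra.
             - assert (0 <= h j w) by (apply dual_nonneg; auto; apply H0l; now left).
               assert (h i w <= rsum (fun k => h k w) l) by (apply IH; auto; intros; apply H0l; now right).
               lra. }
           assert (0 <= h k (v [-] w)) by now apply dual_nonneg. lra.
    + cbn [map lsum]. destruct (Nat.eq_dec k k) as [_|]; [|congruence].
      replace (map (fun i => if Nat.eq_dec i k then w else ws i) l) with (map ws l).
      * apply (vle1 _ _ _ _ Hws2). vs.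
      * apply map_ext_in. intros i Hi. destruct (Nat.eq_dec i k) as [->|]; [contradiction|reflexivity].
Qed.

(* The average of the normalized members of a long row, passed to the limit, gives a
   mass [D] on [[0, v]]; among [m] almost separated pieces one has [D]-mass at most
   [1 / m] and can be cut off without affecting most later rows. *)
Lemma row_extraction (h : nat -> nat -> dual E) (l : nat -> list nat) v :
  rz0 [<=] v -> (forall r, NoDup (l r)) -> (forall r, (r <= length (l r))%nat) ->
  (forall r k, In k (l r) -> rz0 [<=] h r k /\ 1 <= h r k v) ->
  (forall r i k, In i (l r) -> In k (l r) -> i <> k -> disjoint (h r i) (h r k)) ->
  exists y : nat -> bl_riesz E,
    (forall j, rz0 [<=] y j /\ y j [<=] v) /\
    (forall i j, i <> j -> disjoint (y i) (y j)) /\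
    (forall j, exists r k, (j <= r)%nat /\ In k (l r) /\ / 4 <= h r k (y j)).
Proof.
  intros Hv Hnd Hlen Hh Hdis.
  set (A := fun r : nat => (/ INR (length (l r)) [*] lsum (map (fun k => / h r k v [*] h r k) (l r)) : dual E)).
  assert (HAapp : forall r x, A r x = / INR (length (l r)) * rsum (fun k => / h r k v * h r k x) (l r)).
  { intros r x. unfold A.
    change (/ INR (length (l r)) * (lsum (map (fun k => / h r k v [*] h r k) (l r)) : dual E) x =
            / INR (length (l r)) * rsum (fun k => / h r k v * h r k x) (l r)).
    apply f_equal. exact (lsum_app (fun k => / h r k v [*] h r k) (l r) x). }
  assert (HAv : forall r, (0 < r)%nat -> A r v = 1).
  { intros r Hr. rewrite HAapp.
    assert (Hl : 0 < INR (length (l r))) by (apply lt_0_INR; specialize (Hlen r); lia).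
    assert (G : rsum (fun k => / h r k v * h r k v) (l r) = INR (length (l r))).
    { rewrite <- (Rmult_1_r (INR _)), <- rsum_const.
      apply Rle_antisym; apply rsum_le; intros k Hk; destruct (Hh r k Hk) as [_ G];
        rewrite Rinv_l; lra. }
    rewrite G. apply Rinv_l. lra. }
  assert (HA0 : forall r, rz0 [<=] A r).
  { intros r. destruct (Nat.eq_dec (length (l r)) 0) as [Hz|Hz].
    - intros x Hx. rewrite HAapp. destruct (l r); [|discriminate]. simpl. lra.
    - apply scal_nonneg.
      + left. apply Rinv_0_lt_compat, lt_0_INR. lia.
      + apply lsum_nonneg. intros k Hk. destruct (Hh r k Hk) as [G1 G2].
        apply scal_nonneg; auto. left. apply Rinv_0_lt_compat. lra. }
  (* The rows are controlled only through their values at [v], with no norm bound assumed, so the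
     limit is taken only on [0, v]. *)
  assert (HD : exists D : bl_riesz E -> R, forall x, rz0 [<=] x -> x [<=] v -> ucv (fun r => A r x) (D x)).
  { exists (fun x => epsilon (inhabits 0) (ucv (fun r => A r x))). intros x Hx Hxv.
    apply epsilon_spec. apply ucv_ex with (A O v + 1). intros r.
    assert (G1 := dual_nonneg _ _ (HA0 r) Hx). assert (G2 := dual_mono _ _ _ (HA0 r) Hxv).
    assert (G3 := dual_nonneg _ _ (HA0 O) Hv).
    rewrite Rabs_pos_eq by assumption. destruct r as [|r]; [lra|]. rewrite HAv in G2 by lia. lra. }
  destruct HD as [D HD].
  assert (HD1 : forall x, rz0 [<=] x -> x [<=] v -> D x <= 1).
  { intros x Hx Hxv. apply (ucv_le (fun r => A r x) (fun _ => 1)); auto using ucv_const.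
    apply FU_mono with (2 := FU_tail 1). intros r Hr. rewrite <- (HAv r) by lia.
    now apply dual_mono. }
  assert (HD0 : forall x, rz0 [<=] x -> x [<=] v -> 0 <= D x).
  { intros x Hx Hxv. apply (ucv_le (fun _ => 0) (fun r => A r x)); auto using ucv_const.
    apply FU_all. intros r. now apply dual_nonneg. }
  assert (HDsum : forall (ws : nat -> bl_riesz E) l' u, u [<=] v ->
            (forall k, In k l' -> rz0 [<=] ws k) -> lsum (map ws l') [<=] u ->
            rsum (fun k => D (ws k)) l' <= D u).
  { intros ws l'. induction l' as [|k l' IH]; intros u Huv H0 Hs; cbn [map lsum rsum] in *.
    - now apply HD0.
    - assert (G1 : rz0 [<=] ws k) by (apply H0; now left).
      assert (G2 : forall i, In i l' -> rz0 [<=] ws i) by (intros; apply H0; now right).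
      assert (G3 := lsum_nonneg ws l' G2).
      assert (G4 : ws k [<=] u) by (apply (vle2 _ _ _ _ _ _ Hs G3); vs).
      assert (G5 : u [-] ws k [<=] v) by (apply (vle2 _ _ _ _ _ _ Huv G1); vs).
      assert (G6 : rz0 [<=] u [-] ws k) by exact (proj1 (le_diff0 _ _) G4).
      assert (G7 : rsum (fun k => D (ws k)) l' <= D (u [-] ws k)).
      { apply IH; auto. apply (vle1 _ _ _ _ Hs). vs. }
      assert (G8 : D (ws k) + D (u [-] ws k) <= D u).
      { apply (ucv_le (fun r => A r (ws k) + A r (u [-] ws k)) (fun r => A r u)).
        - apply FU_all. intros r. rewrite dualB. lra.
        - apply ucv_add; apply HD; auto. now apply rz_le_trans with u.
        - apply HD; auto. now apply rz_le_trans with (ws k). }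
      lra. }
  destruct (dependent_choice (bl_riesz E) (fun u => rz0 [<=] u /\ u [<=] v /\ 3 / 4 < D u)
    (fun j u u' => u' [<=] u /\ exists y, rz0 [<=] y /\ y [<=] u /\ disjoint y u' /\
       exists r k, (j <= r)%nat /\ In k (l r) /\ / 4 <= h r k y)) as [us Hus].
  - exists v. repeat split; auto using rz_le_refl.
    assert (1 <= D v); [|lra].
    apply (ucv_le (fun _ => 1) (fun r => A r v)); auto using ucv_const, rz_le_refl.
    apply FU_mono with (2 := FU_tail 1). intros r Hr. rewrite HAv by lia. lra.
  - intros j u [Hu0 [Huv HuD]].
    (* Cutting off a piece [w] with D w <= 1 / m costs at most 2 / m, which keeps the mass of the
       remainder above 3 / 4. *)
    destruct (inv_nat_small 2 (D u - 3 / 4)) as [m [Hm0 Hm]]; [lra|].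
    assert (HmR : 0 < INR m) by now apply lt_0_INR.
    destruct (FU_ex _ (FU_and _ _ (HD u Hu0 Huv (D u - 3 / 4) ltac:(lra))
                         (FU_tail (j + 4 * m + 1)))) as [r [Hr1 Hr2]].
    apply Rabs_def2 in Hr1.
    set (b := fun k => if Rle_dec (/ 2) (/ h r k v * h r k u) then true else false).
    set (l' := filter b (l r)).
    assert (Hl' : forall k, In k l' -> In k (l r) /\ / 2 <= h r k u).
    { intros k Hk. apply filter_In in Hk. destruct Hk as [Hk1 Hk2]. split; [assumption|].
      unfold b in Hk2. destruct (Rle_dec (/ 2) (/ h r k v * h r k u)) as [G|G]; [|discriminate].
      destruct (Hh r k Hk1) as [G1 G2].
      apply (Rmult_le_compat_l (h r k v)) in G; [|lra].
      rewrite <- Rmult_assoc, Rinv_r, Rmult_1_l in G by lra. lra. }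
    (* The average exceeds 3 / 4, normalized values are at most 1, and the discarded ones are below
       1 / 2. So at least a quarter of the row survives, and the row has at least 4 m members. *)
    assert (Hlen' : (m <= length l')%nat).
    { assert (Hlr := Hlen r).
      assert (Hlr0 : 0 < INR (length (l r))) by (apply lt_0_INR; lia).
      assert (G : rsum (fun k => / h r k v * h r k u) (l r) <=
                  INR (length l') * 1 + INR (length (l r)) * / 2).
      { apply rsum_filter_le; [| |lra].
        - intros k Hk. destruct (Hh r k Hk) as [G1 G2].
          assert (G3 := dual_mono _ _ _ G1 Huv).
          apply Rmult_le_reg_l with (h r k v); [lra|].
          rewrite <- Rmult_assoc, Rinv_r by lra. lra.
        - intros k Hk. unfold b. destruct (Rle_dec (/ 2) (/ h r k v * h r k u)); [discriminate|lra]. }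
      assert (G2 : A r u > 3 / 4) by lra. rewrite HAapp in G2.
      apply Rgt_lt, (Rmult_lt_compat_l (INR (length (l r)))) in G2; [|assumption].
      rewrite <- Rmult_assoc, Rinv_r, Rmult_1_l in G2 by lra.
      apply INR_le.
      assert (G3 : INR (4 * m) <= INR (length (l r))) by (apply le_INR; lia).
      rewrite mult_INR in G3. simpl in G3. lra. }
    (* With this error, h(2 w - u) = h(u) - 2 h(u - w) >= 1/2 - 1/8, which exceeds the required 1 /
       4. *)
    destruct (split_list (h r) l') with (v := u) (eta := / 16) as [ws [Hws1 Hws2]]; auto.
    + apply NoDup_filter, Hnd.
    + intros k Hk. apply (Hh r k), Hl', Hk.
    + intros i k Hi Hk. apply Hdis; now apply Hl'.
    + lra.
    + assert (Hk : exists k, In k l' /\ D (ws k) <= / INR m).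
      { apply NNPP. intros Hn.
        assert (G1 : rsum (fun _ => / INR m) l' < rsum (fun k => D (ws k)) l' + 0 \/ l' = nil).
        { clear - Hn. induction l' as [|k l' IH]; [now right|left].
          assert (G : / INR m < D (ws k)).
          { apply Rnot_le_lt. intros G. apply Hn. exists k. split; [now left|assumption]. }
          cbn [rsum]. destruct IH as [IH|IH].
          - intros [i [Hi1 Hi2]]. apply Hn. exists i. split; [now right|assumption].
          - lra.
          - subst l'. simpl. lra. }
        destruct G1 as [G1|G1]; [|rewrite G1 in Hlen'; simpl in Hlen'; lia].
        assert (G2 := HDsum ws l' u Huv (fun k Hk => proj1 (Hws1 k Hk)) Hws2).
        assert (G3 := HD1 u Hu0 Huv). rewrite rsum_const in G1.
        assert (G4 : INR m * / INR m <= INR (length l') * / INR m).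
        { apply Rmult_le_compat_r; [left; now apply Rinv_0_lt_compat|now apply le_INR]. }
        rewrite Rinv_r in G4 by lra. lra. }
      destruct Hk as [k [Hk HkD]]. destruct (Hws1 k Hk) as [Hw0 [Hwu Hwh]]. set (w := ws k) in *.
      (* The pieces are only almost separated; (2 w - u)^+ and (u - 2 w)^+ are exactly disjoint. The
         former is the extracted element, the latter the interval left for later ones. *)
      assert (Hu'u : vpos (u [-] 2 [*] w) [<=] u).
      { apply pos_lub; [|assumption].
        apply (vle2 _ _ _ _ _ _ Hw0 Hw0). vs. }
      exists (vpos (u [-] 2 [*] w)). repeat split; auto.
      * apply pos_nonneg.
      * now apply rz_le_trans with u.
      * assert (G : D u <= D (vpos (u [-] 2 [*] w)) + 2 * D w).
        { apply (ucv_le (fun r => A r u) (fun r => A r (vpos (u [-] 2 [*] w)) + 2 * A r w)).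
          - apply FU_all. intros i. assert (G := dual_mono (A i) _ _ (HA0 i) (pos_ge (u [-] 2 [*] w))).
            rewrite dualB, dualZ in G. lra.
          - now apply HD.
          - apply ucv_add; [|apply ucv_scal]; apply HD; auto using pos_nonneg;
              now apply rz_le_trans with u. }
        unfold Rdiv in Hm. lra.
      * exists (vpos (2 [*] w [-] u)). split; [apply pos_nonneg|]. split; [|split].
        -- apply pos_lub; [|assumption]. apply (vle2 _ _ _ _ _ _ Hwu Hwu). vs.
        -- apply disjoint_pos_sub.
        -- exists r, k. destruct (Hl' k Hk) as [G1 G2]. repeat split; [lia|assumption|].
           destruct (Hh r k G1) as [G3 _].
           assert (G4 := dual_mono _ _ _ G3 (pos_ge (2 [*] w [-] u))).
           rewrite dualB, dualZ in G4. rewrite dualB in Hwh. lra.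
  - assert (Hmono : forall i n, us (i + n)%nat [<=] us i).
    { intros i n. induction n as [|n IH]; [rewrite Nat.add_0_r; apply rz_le_refl|].
      rewrite Nat.add_succ_r. apply rz_le_trans with (2 := IH). apply Hus. }
    destruct (nat_choice _ _ (fun j => proj2 (proj2 (Hus j)))) as [y Hy].
    assert (Hlt : forall i j, (i < j)%nat -> disjoint (y i) (y j)).
    { intros i j Hij. destruct (Hy i) as [G1 [G2 [G3 _]]]. destruct (Hy j) as [G4 [G5 _]].
      apply disjoint_mono with (y i) (us (S i)); auto using rz_le_refl.
      apply rz_le_trans with (1 := G5). replace j with (S i + (j - S i))%nat by lia. apply Hmono. }
    exists y. repeat split.
    + apply Hy.
    + destruct (Hy j) as [_ [G _]]. apply rz_le_trans with (1 := G). apply Hus.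
    + intros i j Hij. destruct (Nat.lt_gt_cases i j) as [G _]. destruct (G Hij) as [G1|G1];
        [now apply Hlt|now apply disjointC, Hlt].
    + intros j. apply Hy.
Qed.

End DisjointExtraction.

(** * Uniform smallness of the tails *)

Section UniformIntegrability.
Context {E : BanachLattice}.
Implicit Types x y z v w : bl_riesz E.

Definition bounded_form (L : dual E -> R) (C : R) : Prop :=
  (forall f g : dual E, L (f [+] g) = L f + L g) /\
  (forall a (f : dual E), L (a [*] f) = a * L f) /\ 0 <= C /\
  (forall (f : dual E) c, 0 <= c -> dual_bound E f c -> Rabs (L f) <= C * c).

Lemma bounded_formB L C (f g : dual E) : bounded_form L C -> L (f [-] g) = L f - L g.
Proof.
  intros [H1 [H2 _]]. rewrite H1, (rz_oppE (g : dual_riesz E)), H2. ring.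
Qed.

(** The bound is required for all [H] above [H0]: a form [L] need not be positive, so its values on
    the tails need not be monotone in [H]. *)
Definition tails_vanish (P : nat -> dual E) (L : dual E -> R) : Prop :=
  forall delta, 0 < delta -> exists H0 : dual E, rz0 [<=] H0 /\
    forall (H : dual E) n, H0 [<=] H -> Rabs (L (vpos (P n [-] H))) <= delta.

(** Any overlap of [d k] with an earlier term is governed by 2^(-k) P(n_k). The factor 2^k makes
    these corrections summable in norm. *)
Definition almost_disjoint (P : nat -> dual E) (d : nat -> dual E) (n : nat -> nat) : Prop :=
  (forall k, rz0 [<=] d k /\ d k [<=] P (n k)) /\
  (forall i k, (i < k)%nat -> d k [<=] vpos (P (n k) [-] 2 ^ k [*] P (n i))).

Variable P : nat -> dual E.
Hypothesis P_pos : forall n, rz0 [<=] P n.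

(** At step [k] the failing tail is sought above 2^k times the sum [S] of all the P(n_i) used so
    far; that one threshold serves every i < k. *)
Lemma almost_disjoint_exists L : ~ tails_vanish P L ->
  exists delta d n, 0 < delta /\ almost_disjoint P d n /\ forall k, delta < Rabs (L (d k)).
Proof.
  intros Hn.
  assert (Hd : exists delta, 0 < delta /\ forall H0 : dual E, rz0 [<=] H0 ->
            exists (H : dual E) n, H0 [<=] H /\ delta < Rabs (L (vpos (P n [-] H)))).
  { apply NNPP. intros Hn1. apply Hn. intros delta Hdelta.
    apply NNPP. intros Hn2. apply Hn1. exists delta. split; [assumption|].
    intros H0 HH0. apply NNPP. intros Hn3. apply Hn2. exists H0. split; [assumption|].
    intros H n HH. apply Rnot_lt_le. intros Hlt. apply Hn3. now exists H, n. }
  destruct Hd as [delta [Hdelta Hd]].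
  destruct (dependent_choice (dual E) (fun S => rz0 [<=] S)
    (fun k S S' => exists Hm : dual E * nat, 2 ^ k [*] S [<=] fst Hm /\
       delta < Rabs (L (vpos (P (snd Hm) [-] fst Hm))) /\ S' = S [+] P (snd Hm))) as [S HS].
  - exists rz0. apply rz_le_refl.
  - intros k S HS. assert (Hk : 0 < 2 ^ k) by (apply pow_lt; lra).
    destruct (Hd (2 ^ k [*] S)) as [H [n [H1 H2]]]; [apply scal_nonneg; auto; lra|].
    exists (S [+] P n). split; [now apply add_nonneg|]. now exists (H, n).
  - destruct (nat_choice _ _ (fun k => proj2 (HS k))) as [Hm HHm].
    set (n := fun k => snd (Hm k)).
    assert (HSmono : forall i j, S i [<=] S (i + j)%nat).
    { intros i j. induction j as [|j IH]; [rewrite Nat.add_0_r; apply rz_le_refl|].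
      rewrite Nat.add_succ_r. destruct (HHm (i + j)%nat) as [_ [_ ->]].
      apply (vle2 _ _ _ _ _ _ IH (P_pos (snd (Hm (i + j)%nat)))). vs. }
    assert (HSP : forall i k, (i < k)%nat -> P (n i) [<=] S k).
    { intros i k Hik. apply rz_le_trans with (S (Datatypes.S i)).
      - destruct (HHm i) as [_ [_ ->]]. apply (vle1 _ _ _ _ (proj1 (HS i))). unfold n. vs.
      - replace k with (Datatypes.S i + (k - Datatypes.S i))%nat by lia. apply HSmono. }
    exists delta, (fun k => vpos (P (n k) [-] fst (Hm k))), n.
    split; [assumption|]. split; [split|].
    + intros k. split; [apply pos_nonneg|]. apply pos_lub; [|apply P_pos].
      assert (G : rz0 [<=] fst (Hm k)).
      { apply rz_le_trans with (2 := proj1 (HHm k)). apply scal_nonneg; [|apply HS].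
        left; apply pow_lt; lra. }
      apply (vle1 _ _ _ _ G). vs.
    + intros i k Hik. apply pos_mono.
      assert (G : 2 ^ k [*] P (n i) [<=] fst (Hm k)).
      { apply rz_le_trans with (2 := proj1 (HHm k)). apply rz_le_scal; [|now apply HSP].
        left; apply pow_lt; lra. }
      apply (vle1 _ _ _ _ G). vs.
    + intros k. apply (HHm k).
Qed.

Variables (d : nat -> dual E) (n : nat -> nat) (C : R).
Hypothesis d_disj : almost_disjoint P d n.
Hypothesis C_pos : 0 <= C.
Hypothesis P_bound : forall k, dual_bound E (P k) C.

Definition tail_mass K m : dual E := vsum (fun i => (/ 2) ^ (K + i) [*] P (n (K + i)%nat)) m.

Definition trimmed K m k : dual E := vpos (d k [-] tail_mass K m).

Lemma tail_mass_nonneg K m : rz0 [<=] tail_mass K m.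
Proof. apply vsum_nonneg. intros i. apply scal_nonneg; [left; apply pow_lt; lra|apply P_pos]. Qed.

Lemma tail_mass_ge K m k : (K <= k < K + m)%nat -> (/ 2) ^ k [*] P (n k) [<=] tail_mass K m.
Proof.
  intros Hk. replace k with (K + (k - K))%nat by lia.
  assert (Hi : (k - K < m)%nat) by lia. revert Hi. generalize (k - K)%nat. clear k Hk. intros i Hi.
  unfold tail_mass. induction m as [|m IH]; [lia|]. cbn [vsum].
  assert (G1 : rz0 [<=] (/ 2) ^ (K + m) [*] P (n (K + m)%nat)).
  { apply scal_nonneg; [left; apply pow_lt; lra|apply P_pos]. }
  destruct (Nat.eq_dec i m) as [->|Hne].
  - assert (G2 := tail_mass_nonneg K m). unfold tail_mass in G2.
    apply (vle1 _ _ _ _ G2). vs.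
  - apply rz_le_trans with (1 := IH ltac:(lia)).
    apply (vle1 _ _ _ _ G1). vs.
Qed.

Lemma tail_mass_bound K m : dual_bound E (tail_mass K m) (C * (2 * (/ 2) ^ K)).
Proof.
  assert (G : dual_bound E (tail_mass K m) (C * (2 * (/ 2) ^ K - 2 * (/ 2) ^ (K + m)))).
  { induction m as [|m IH].
    - rewrite Nat.add_0_r. unfold tail_mass. cbn [vsum]. intros x.
      change (Rabs 0 <= C * (2 * (/ 2) ^ K - 2 * (/ 2) ^ K) * nrm x).
      rewrite Rabs_R0. lra.
    - replace (C * (2 * (/ 2) ^ K - 2 * (/ 2) ^ (K + S m))) with
        (C * (2 * (/ 2) ^ K - 2 * (/ 2) ^ (K + m)) + Rabs ((/ 2) ^ (K + m)) * C).
      + apply dual_bound_add; [exact IH|]. apply dual_bound_scal, P_bound.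
      + rewrite Rabs_pos_eq by (left; apply pow_lt; lra).
        rewrite Nat.add_succ_r. simpl. field. }
  intros x. apply Rle_trans with (1 := G x). apply Rmult_le_compat_r; [apply nrm_nonneg|].
  apply Rmult_le_compat_l; [assumption|].
  assert (0 < (/ 2) ^ (K + m)) by (apply pow_lt; lra). lra.
Qed.

Lemma trimmed_nonneg K m k : rz0 [<=] trimmed K m k.
Proof. apply pos_nonneg. Qed.

Lemma trimmed_le K m k : trimmed K m k [<=] d k.
Proof.
  apply pos_lub; [|apply d_disj]. apply (vle1 _ _ _ _ (tail_mass_nonneg K m)). vs.
Qed.

Lemma trimmed_ge K m k : d k [-] trimmed K m k [<=] tail_mass K m.
Proof. apply (vle1 _ _ _ _ (pos_ge (d k [-] tail_mass K m))). unfold trimmed. vs. Qed.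

(** For i < k, put a = P(n_i) - 2^(-k) P(n_k). The trimmed [d i] lies below a^+ because the tail
    mass contains 2^(-k) P(n_k); the trimmed [d k] lies below 2^k a^- by almost disjointness. *)
Lemma trimmed_disjoint K m i k : (K <= i < K + m)%nat -> (K <= k < K + m)%nat -> i <> k ->
  disjoint (trimmed K m i) (trimmed K m k).
Proof.
  assert (Hlt : forall i k, (K <= i < K + m)%nat -> (K <= k < K + m)%nat -> (i < k)%nat ->
            disjoint (trimmed K m i) (trimmed K m k)).
  { clear i k. intros i k Hi Hk Hik.
    assert (H2 : 0 < 2 ^ k) by (apply pow_lt; lra).
    assert (H3 : / 2 ^ k = (/ 2) ^ k) by (symmetry; apply pow_inv).
    apply disjoint_mono with (vpos (P (n i) [-] (/ 2) ^ k [*] P (n k)))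
      (2 ^ k [*] vpos ((/ 2) ^ k [*] P (n k) [-] P (n i))).
    - apply trimmed_nonneg.
    - apply trimmed_nonneg.
    - apply pos_mono. destruct d_disj as [H1 _]. destruct (H1 i) as [_ H4].
      apply (vle2 _ _ _ _ _ _ H4 (tail_mass_ge K m k Hk)). vs.
    - apply rz_le_trans with (1 := trimmed_le K m k).
      destruct d_disj as [_ H1]. apply rz_le_trans with (1 := H1 i k Hik).
      rewrite <- pos_scal by assumption. apply pos_mono.
      replace (2 ^ k [*] ((/ 2) ^ k [*] P (n k) [-] P (n i))) with
        (P (n k) [-] 2 ^ k [*] P (n i)); [apply rz_le_refl|].
      rewrite <- H3. vs.
    - rewrite <- (rz_scal1 (vpos (P (n i) [-] (/ 2) ^ k [*] P (n k)))).
      apply disjoint_scal; try lra; try apply pos_nonneg. apply disjoint_pos_sub. }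
  intros Hi Hk Hne. destruct (Nat.lt_gt_cases i k) as [G _]. destruct (G Hne).
  - now apply Hlt.
  - apply disjointC. now apply Hlt.
Qed.

Lemma trimmed_form L CL K m k : bounded_form L CL ->
  Rabs (L (d k)) - CL * (C * (2 * (/ 2) ^ K)) <= Rabs (L (trimmed K m k)).
Proof.
  intros HL.
  assert (Hb : dual_bound E (d k [-] trimmed K m k : dual E) (C * (2 * (/ 2) ^ K))).
  { apply dual_bound_mono with (tail_mass K m).
    - exact (proj1 (le_diff0 _ _) (trimmed_le K m k)).
    - apply trimmed_ge.
    - apply tail_mass_bound. }
  assert (G : Rabs (L (d k [-] trimmed K m k)) <= CL * (C * (2 * (/ 2) ^ K))).
  { destruct HL as [_ [_ [_ HL]]]. apply HL; [|exact Hb].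
    assert (0 < (/ 2) ^ K) by (apply pow_lt; lra). nra. }
  rewrite (bounded_formB L CL _ _ HL) in G.
  assert (G2 := Rabs_triang (L (d k) - L (trimmed K m k)) (L (trimmed K m k))).
  replace (L (d k) - L (trimmed K m k) + L (trimmed K m k)) with (L (d k)) in G2 by ring. lra.
Qed.

End UniformIntegrability.

Lemma infinite_sublist (Q : nat -> Prop) : (forall K, exists k, (K <= k)%nat /\ Q k) ->
  forall r K, exists l m, NoDup l /\ length l = r /\ forall k, In k l -> (K <= k < K + m)%nat /\ Q k.
Proof.
  intros HQ r K. induction r as [|r [l [m [H1 [H2 H3]]]]].
  - exists nil, O. repeat split; [constructor|destruct H|destruct H|destruct H].
  - destruct (HQ (K + m)%nat) as [k [Hk1 Hk2]].
    exists (k :: l), (S (k - K)). repeat split.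
    + constructor; [|assumption]. intros Hin. apply H3 in Hin. lia.
    + simpl. now rewrite H2.
    + destruct H as [<-|H]; [lia|]. apply H3 in H. lia.
    + destruct H as [<-|H]; [lia|]. apply H3 in H. lia.
    + destruct H as [<-|H]; [assumption|]. now apply H3.
Qed.

(** * Tails of the positive parts of a weak-* null sequence *)

Section WeakStarNull.
Context {E : BanachLattice}.
Implicit Types x y z v w : bl_riesz E.
Hypothesis interpolation : sigma_interpolation E.
Variables (f : nat -> dual E) (C : R).
Hypothesis f_null : forall x, Un_cv (fun n => f n x) 0.
Hypothesis C_pos : 0 <= C.
Hypothesis f_bound : forall n, dual_bound E (f n) C.

Let P n : dual E := vpos (f n).

Lemma positive_part_nonneg n : rz0 [<=] P n.
Proof. apply pos_nonneg. Qed.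
Lemma positive_part_bound n : dual_bound E (P n) C.
Proof. now apply dual_bound_vpos. Qed.

(** Trimming from a large [K] costs less than tau / 2 at [w], so the trimmed functionals scaled by 2
    / tau form rows as in [row_extraction]. The disjoint y_j in [0, w] then have d_k(y_j) >= tau / 8
    for suitable k; an element of [0, y_j] on which f_(n_k) is at least tau / 16 is a hump, against
    [no_hump]. *)
Lemma almost_disjoint_vanish d n w tau : almost_disjoint P d n -> rz0 [<=] w -> 0 < tau ->
  (forall K, exists k, (K <= k)%nat /\ tau <= d k w) -> False.
Proof.
  intros Hd Hw Htau Hinf.
  destruct (pow2_small (2 * C * nrm w) (tau / 2)) as [K HK]; [lra|].
  destruct (nat_choice (list nat * nat) (fun r lm => NoDup (fst lm) /\ length (fst lm) = r /\
      forall k, In k (fst lm) -> (K <= k < K + snd lm)%nat /\ tau <= d k w)) as [lm Hlm].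
  { intros r. destruct (infinite_sublist _ Hinf r K) as [l [m H]]. now exists (l, m). }
  set (h := fun r k => (2 / tau [*] trimmed P d n K (snd (lm r)) k : dual E)).
  assert (H2t : 0 < 2 / tau) by (apply Rdiv_lt_0_compat; lra).
  destruct (row_extraction h (fun r => fst (lm r)) w) as [y [Hy1 [Hy2 Hy3]]].
  - assumption.
  - intros r. apply Hlm.
  - intros r. destruct (Hlm r) as [_ [-> _]]. lia.
  - intros r k Hk. split.
    + apply scal_nonneg; [lra|]. apply trimmed_nonneg.
    + destruct (Hlm r) as [_ [_ H3]]. destruct (H3 k Hk) as [Hk1 Hk2].
      assert (G := dle_app _ _ w (trimmed_ge P d n K (snd (lm r)) k) Hw).
      change (d k w + - trimmed P d n K (snd (lm r)) k w <= tail_mass P n K (snd (lm r)) w) in G.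
      assert (G2 := dual_bound_app _ _ w (tail_mass_bound P n C C_pos positive_part_bound K (snd (lm r)))).
      change (1 <= 2 / tau * trimmed P d n K (snd (lm r)) k w).
      apply Rmult_le_reg_l with (tau / 2); [lra|].
      replace (tau / 2 * (2 / tau * trimmed P d n K (snd (lm r)) k w))
        with (trimmed P d n K (snd (lm r)) k w) by (field; lra). lra.
  - intros r i k Hi Hk Hne. destruct (Hlm r) as [_ [_ H3]].
    apply disjoint_scal; try lra; try apply trimmed_nonneg.
    apply trimmed_disjoint; auto using positive_part_nonneg; [apply (H3 i Hi)|apply (H3 k Hk)].
  - destruct (nat_choice (bl_riesz E * nat) (fun j ym => rz0 [<=] fst ym /\ fst ym [<=] y j /\
        tau / 16 <= Rabs (f (snd ym) (fst ym)))) as [ym Hym].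
    { intros j. destruct (Hy3 j) as [r [k [_ [Hk Hh]]]].
      destruct (Hy1 j) as [Hyj _].
      change (/ 4 <= 2 / tau * trimmed P d n K (snd (lm r)) k (y j)) in Hh.
      apply (Rmult_le_compat_l (tau / 2)) in Hh; [|lra].
      replace (tau / 2 * (2 / tau * trimmed P d n K (snd (lm r)) k (y j)))
        with (trimmed P d n K (snd (lm r)) k (y j)) in Hh by (field; lra).
      assert (G1 := dle_app _ _ _ (trimmed_le P positive_part_nonneg d n Hd K (snd (lm r)) k) Hyj).
      assert (G2 := dle_app _ _ _ (proj2 (proj1 Hd k)) Hyj).
      destruct (vpos_dual_approx (f (n k)) (y j) (tau / 16) Hyj) as [z [Hz1 [Hz2 Hz3]]]; [lra|].
      exists (z, n k). cbn [fst snd]. repeat split; auto.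
      apply Rle_trans with (2 := Rle_abs _). unfold P in G2. lra. }
    apply (no_hump interpolation f (fun j => fst (ym j)) (fun j => snd (ym j)) w (tau / 16)); auto.
    + lra.
    + intros j. apply Hym.
    + intros m. apply rz_le_trans with (vsum y m).
      * induction m as [|m IH]; cbn [vsum]; [apply rz_le_refl|].
        apply le_add_mono; [assumption|apply Hym].
      * apply vsum_disjoint_le; auto; intros i; apply Hy1.
    + intros j. apply Hym.
Qed.

(** The pointwise case serves to show that the limits of the truncations exhaust the limit of the
    positive parts as [H] grows. *)
Lemma tails_vanish_eval x : rz0 [<=] x -> tails_vanish P (fun g => g x).
Proof.
  intros Hx. apply NNPP. intros Hn.
  destruct (almost_disjoint_exists P positive_part_nonneg _ Hn) as [delta [d [n [Hdelta [Hd Hbig]]]]].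
  apply (almost_disjoint_vanish d n x delta Hd Hx Hdelta).
  intros K. exists K. split; [lia|]. specialize (Hbig K).
  rewrite Rabs_pos_eq in Hbig; [lra|]. apply dual_nonneg; [|assumption]. apply Hd.
Qed.

Variables (u0 : bl_riesz E) (G : (E -> E) -> Prop).
Hypothesis u0_pos : rz0 [<=] u0.
Hypothesis G_hom : forall T, G T -> positive_linear_op E T /\ adjoint_lattice_hom E T.
Hypothesis G_dominates : forall x : E, bl_le bl_zero x ->
  exists T, G T /\ bl_le x (bl_scal (bl_norm x) (T u0)).
Hypothesis G_bounded : forall (xs : nat -> E) (Ts : nat -> E -> E),
  (forall n, bl_le bl_zero (xs n) /\ bl_le (xs n) u0) ->
  (forall n m, n <> m -> bl_disjoint E (xs n) (xs m)) ->
  (forall n, G (Ts n)) ->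
  exists v : E, bl_le bl_zero v /\ forall n, bl_le (Ts n (xs n)) v.

(** The homomorphism property at the trivial supremum of [g] and [g] already yields this, since
    [dual_is_sup] contains membership in the dual. *)
Lemma adjoint_in_dual T (g : dual E) : G T -> in_dual E (adjoint E T g).
Proof.
  intros HT. destruct (G_hom T HT) as [_ Hh].
  apply (Hh g g g (dualP g) (dualP g)). split; [apply dualP|].
  repeat split; intros; try apply dle_refl; assumption.
Qed.

Lemma adjoint_disjoint T (g h g' h' : dual E) : G T ->
  (forall x, g' x = g (T x)) -> (forall x, h' x = h (T x)) ->
  disjoint g h -> disjoint g' h'.
Proof.
  intros HT Hg Hh Hd. destruct (G_hom T HT) as [_ Hhom].
  apply join_disjoint in Hd.
  assert (HS : dual_is_sup E g h (g [+] h : dual E)).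
  { rewrite <- Hd. split; [apply dualP|]. split; [exact (join_l (g : dual_riesz E) h)|].
    split; [exact (join_r (g : dual_riesz E) h)|].
    intros k Hk H1 H2. exact (join_lub (g : dual_riesz E) h (MkDual k Hk) H1 H2). }
  destruct (Hhom _ _ _ (dualP g) (dualP h) HS) as [_ [H1 [H2 H3]]].
  apply disjoint_of_join. apply rz_le_antisym.
  - apply join_lub; intros x Hx.
    + change (g' x <= g' x + h' x). rewrite Hg, Hh. exact (H1 x Hx).
    + change (h' x <= g' x + h' x). rewrite Hg, Hh. exact (H2 x Hx).
  - intros x Hx. change (g' x + h' x <= (join g' h' : dual E) x). rewrite Hg, Hh.
    apply (H3 (join g' h' : dual E)); [apply dualP| | |assumption].
    + intros y Hy. unfold adjoint. rewrite <- Hg. exact (join_l (g' : dual_riesz E) h' y Hy).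
    + intros y Hy. unfold adjoint. rewrite <- Hh. exact (join_r (g' : dual_riesz E) h' y Hy).
Qed.

(* If the trimmed functionals keep [L]-mass, their signed sum has norm of order [m], so
   a unit vector [z <= T u0] gives mass to many of them at once. *)
Lemma tails_vanish_form L CL : bounded_form L CL -> tails_vanish P L.
Proof.
  intros HL. apply NNPP. intros Hn.
  destruct (almost_disjoint_exists P positive_part_nonneg _ Hn) as [delta [d [n [Hdelta [Hd Hbig]]]]].
  assert (HCL : 0 <= CL) by apply HL.
  (* Chosen so that CL tau < delta / 2: a signed sum with L-value at least m delta / 2 then cannot
     have norm at most m tau. *)
  set (tau := delta / (4 * (CL + 1))).
  assert (Htau : 0 < tau) by (apply Rdiv_lt_0_compat; lra).
  assert (Htau2 : tau * (CL + 1) = delta / 4) by (unfold tau; field; lra).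
  assert (H2t : 0 < 2 / tau) by (apply Rdiv_lt_0_compat; lra).
  assert (Hrow : forall r, exists row : list nat * (nat -> dual E) * (nat -> dual E) * (E -> E),
    let '(l, h, g, T) := row in
    NoDup l /\ (r <= length l)%nat /\ G T /\
    (forall k, In k l -> (r <= k)%nat /\ rz0 [<=] g k /\ g k [<=] d k /\
       rz0 [<=] h k /\ 1 <= h k u0 /\ forall x, h k x = 2 / tau * g k (T x)) /\
    (forall i k, In i l -> In k l -> i <> k -> disjoint (h i) (h k))).
  { intros r.
    destruct (pow2_small (2 * C * CL) (delta / 2)) as [K0 HK0]; [lra|].
    (* [K0] makes the trimming loss under [L] at most delta / 2. Adding [r] forces the indices of
       row [r] to be at least [r], so infinitely many of them arise in the end. *)
    set (K := (K0 + r)%nat).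
    assert (HK : CL * (C * (2 * (/ 2) ^ K)) <= delta / 2).
    { assert (G1 : (/ 2) ^ K <= (/ 2) ^ K0).
      { unfold K. rewrite pow_add. assert (0 < (/ 2) ^ K0) by (apply pow_lt; lra).
        assert ((/ 2) ^ r <= 1) by (rewrite <- (pow1 r); apply pow_incr; lra). nra. }
      assert (0 <= C * CL) by now apply Rmult_le_pos. nra. }
    (* The sum of the g_k(z) will exceed m tau. Terms below tau / 2 account for at most m tau / 2
       and each other term for at most C, so this [m] leaves at least [r] large terms. *)
    destruct (INR_unbounded (2 * (C + 1) * (INR r + 1) / tau)) as [m Hm].
    assert (Hm2 : 2 * (C + 1) * (INR r + 1) < INR m * tau).
    { apply (Rmult_lt_compat_r tau) in Hm; [|assumption].
      replace (2 * (C + 1) * (INR r + 1) / tau * tau) with (2 * (C + 1) * (INR r + 1)) in Hm by (field; lra).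
      assumption. }
    assert (Hm0 : 0 < INR m).
    { assert (Hr := pos_INR r). nra. }
    set (g := trimmed P d n K m).
    set (sg := fun k => if Rle_dec 0 (L (g k)) then 1 else -1).
    set (F := (lsum (map (fun k => sg k [*] g k) (seq K m)) : dual E)).
    assert (HLF : forall l, L (lsum (map (fun k => sg k [*] g k) l)) = rsum (fun k => Rabs (L (g k))) l).
    { induction l as [|k l IH]; cbn [map lsum rsum].
      - rewrite <- (rz_scal0 (rz0 : dual_riesz E)). destruct HL as [_ [-> _]]. ring.
      - destruct HL as [-> [HLZ _]]. rewrite IH, HLZ. f_equal. unfold sg.
        destruct (Rle_dec 0 (L (g k))); [rewrite Rabs_pos_eq|rewrite Rabs_left]; lra. }
    assert (HLF2 : INR m * (delta / 2) <= L F).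
    { unfold F. rewrite HLF.
      replace (INR m * (delta / 2)) with (rsum (fun _ => delta / 2) (seq K m))
        by (now rewrite rsum_const, length_seq).
      apply rsum_le. intros k Hk.
      assert (G1 := trimmed_form P positive_part_nonneg d n C Hd C_pos positive_part_bound L CL K m k HL).
      specialize (Hbig k). fold g in G1. lra. }
    assert (HFx : exists x, INR m * tau * nrm x < Rabs (F x)).
    { apply NNPP. intros Hno.
      assert (G1 : Rabs (L F) <= CL * (INR m * tau)).
      { apply HL; [nra|]. intros x. apply Rnot_lt_le. intros Hlt. apply Hno. now exists x. }
      assert (G2 := Rle_abs (L F)). nra. }
    destruct HFx as [x Hx].
    assert (Hx0 : 0 < nrm x).
    { destruct (nrm_nonneg x) as [Hp|Hz]; [assumption|exfalso].
      assert (x = rz0) by (apply nrm_eq0; auto). subst x.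
      rewrite dual0, Rabs_R0, nrm0 in Hx. lra. }
    set (z := / nrm x [*] vabs x).
    assert (Hinv : 0 < / nrm x) by now apply Rinv_0_lt_compat.
    assert (Hz : rz0 [<=] z) by (apply scal_nonneg; [lra|apply vabs_nonneg]).
    assert (Hz1 : nrm z = 1).
    { unfold z. rewrite nrm_scal, nrm_vabs, Rabs_pos_eq by lra. apply Rinv_l. lra. }
    assert (Hsum : INR m * tau < rsum (fun k => g k z) (seq K m)).
    { assert (G1 : forall l, Rabs ((lsum (map (fun k => sg k [*] g k) l) : dual E) x) <=
                    nrm x * rsum (fun k => g k z) l).
      { induction l as [|k l IH]; cbn [map lsum rsum].
        - change (Rabs 0 <= nrm x * 0). rewrite Rabs_R0. lra.
        - change (Rabs (sg k * g k x + (lsum (map (fun k => sg k [*] g k) l) : dual E) x) <=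
                  nrm x * (g k z + rsum (fun k => g k z) l)).
          apply Rle_trans with (1 := Rabs_triang _ _).
          assert (G2 : Rabs (sg k * g k x) <= nrm x * g k z).
          { rewrite Rabs_mult. replace (Rabs (sg k)) with 1.
            - unfold z. rewrite dualZ, <- Rmult_assoc, Rinv_r, !Rmult_1_l by lra.
              apply dual_abs_vabs, trimmed_nonneg.
            - unfold sg. destruct (Rle_dec 0 (L (g k))); [rewrite Rabs_pos_eq|rewrite Rabs_left]; lra. }
          lra. }
      specialize (G1 (seq K m)). fold F in G1.
      apply Rmult_lt_reg_l with (nrm x); [assumption|]. lra. }
    destruct (G_dominates z Hz) as [T [HT HzT]].
    change (z [<=] nrm z [*] (T u0 : bl_riesz E)) in HzT. rewrite Hz1, rz_scal1 in HzT.
    set (b := fun k => if Rle_dec (tau / 2) (g k z) then true else false).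
    set (l := filter b (seq K m)).
    assert (Hl : forall k, In k l -> (K <= k < K + m)%nat /\ tau / 2 <= g k z).
    { intros k Hk. apply filter_In in Hk. destruct Hk as [Hk1 Hk2]. apply in_seq in Hk1.
      split; [assumption|]. unfold b in Hk2. destruct (Rle_dec (tau / 2) (g k z)); [assumption|discriminate]. }
    set (h := fun k => (2 / tau [*] MkDual _ (adjoint_in_dual T (g k) HT) : dual E)).
    assert (Tpos : forall k, rz0 [<=] h k).
    { intros k. apply scal_nonneg; [lra|]. intros y Hy.
      change (0 <= g k (T y)). apply dual_nonneg; [apply trimmed_nonneg|].
      apply (G_hom T HT). exact Hy. }
    exists (l, h, g, T). split; [apply NoDup_filter, seq_NoDup|]. split; [|split; [assumption|split]].
    - apply INR_le.
      assert (G1 : rsum (fun k => g k z) (seq K m) <=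
                   INR (length l) * (C + 1) + INR (length (seq K m)) * (tau / 2)).
      { apply rsum_filter_le; [| |lra].
        - intros k _. assert (G1 := dle_app _ _ _ (trimmed_le P positive_part_nonneg d n Hd K m k) Hz).
          assert (G2 := dle_app _ _ _ (proj2 (proj1 Hd k)) Hz).
          assert (G3 := dual_bound_app _ _ z (positive_part_bound (n k))). rewrite Hz1 in G3.
          unfold g. lra.
        - intros k _. unfold b. destruct (Rle_dec (tau / 2) (g k z)); [discriminate|lra]. }
      rewrite length_seq in G1.
      apply Rmult_le_reg_r with (C + 1); [lra|]. lra.
    - intros k Hk. destruct (Hl k Hk) as [Hk1 Hk2].
      split; [unfold K in Hk1; lia|]. split; [apply trimmed_nonneg|].
      split; [apply (trimmed_le P positive_part_nonneg d n Hd)|]. split; [apply Tpos|]. split; [|reflexivity].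
      change (1 <= 2 / tau * g k (T u0)).
      assert (G1 := dual_mono (g k) _ _ (trimmed_nonneg P d n K m k) HzT).
      apply Rmult_le_reg_l with (tau / 2); [lra|].
      replace (tau / 2 * (2 / tau * g k (T u0))) with (g k (T u0)) by (field; lra). lra.
    - intros i k Hi Hk Hne.
      apply adjoint_disjoint with (T := T) (g := 2 / tau [*] g i) (h := 2 / tau [*] g k);
        auto; try reflexivity.
      apply disjoint_scal; try lra; try apply trimmed_nonneg.
      apply trimmed_disjoint; auto using positive_part_nonneg; now apply Hl. }
  destruct (nat_choice _ _ Hrow) as [row Hrows].
  set (l := fun r => let '(l, _, _, _) := row r in l).
  set (h := fun r => let '(_, h, _, _) := row r in h).
  set (g := fun r => let '(_, _, g, _) := row r in g).
  set (T := fun r => let '(_, _, _, T) := row r in T).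
  assert (HR : forall r, NoDup (l r) /\ (r <= length (l r))%nat /\ G (T r) /\
    (forall k, In k (l r) -> (r <= k)%nat /\ rz0 [<=] g r k /\ g r k [<=] d k /\
       rz0 [<=] h r k /\ 1 <= h r k u0 /\ forall x, h r k x = 2 / tau * g r k (T r x)) /\
    (forall i k, In i (l r) -> In k (l r) -> i <> k -> disjoint (h r i) (h r k))).
  { intros r. specialize (Hrows r). unfold l, h, g, T. destruct (row r) as [[[l' h'] g'] T'].
    exact Hrows. }
  clearbody l h g T. clear Hrows row Hrow.
  destruct (row_extraction h l u0) as [y [Hy1 [Hy2 Hy3]]].
  { exact u0_pos. }
  { intros r. exact (proj1 (HR r)). }
  { intros r. exact (proj1 (proj2 (HR r))). }
  { intros r k Hk. destruct (HR r) as [_ [_ [_ [H1 _]]]].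
    destruct (H1 k Hk) as [_ [_ [_ [H2 [H3 _]]]]]. now split. }
  { intros r. exact (proj2 (proj2 (proj2 (proj2 (HR r))))). }
  destruct (nat_choice (nat * nat) (fun j rk => (j <= fst rk)%nat /\ In (snd rk) (l (fst rk)) /\
     / 4 <= h (fst rk) (snd rk) (y j))) as [rk Hrk].
  { intros j. destruct (Hy3 j) as [r [k H]]. now exists (r, k). }
  destruct (G_bounded y (fun j => T (fst (rk j)))) as [v [Hv Hbv]].
  - exact Hy1.
  - intros i j Hij. change (disjoint (vabs (y i)) (vabs (y j))).
    rewrite !vabs_id by apply Hy1. now apply Hy2.
  - intros j. exact (proj1 (proj2 (proj2 (HR (fst (rk j)))))).
  (* The value 1 / 4 of [h], undone by the scaling 2 / tau, is g_k(T y_j) >= tau / 8; positivity and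
     T y_j <= v carry it over to [v]. *)
  - apply (almost_disjoint_vanish d n v (tau / 8) Hd Hv); [lra|].
    intros j. destruct (Hrk j) as [G1 [G2 G3]]. set (r := fst (rk j)) in *. set (k := snd (rk j)) in *.
    destruct (HR r) as [_ [_ [_ [H1 _]]]]. destruct (H1 k G2) as [H2 [H3 [H4 [_ [_ H5]]]]].
    exists k. split; [lia|].
    rewrite H5 in G3. apply (Rmult_le_compat_l (tau / 2)) in G3; [|lra].
    replace (tau / 2 * (2 / tau * g r k (T r (y j)))) with (g r k (T r (y j))) in G3 by (field; lra).
    assert (H6 := dual_mono (g r k) _ _ H3 (Hbv j)).
    assert (H7 := dle_app _ _ _ H4 Hv). fold r in H6. lra.
Qed.

End WeakStarNull.

(** * Small tails contradict a lower bound on the form *)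

Lemma dual_bound_dominated {E : BanachLattice} (g h : dual E) c :
  dominated h g -> dual_bound E h c -> dual_bound E g c.
Proof.
  intros [H1 H2] Hh x. apply Rle_trans with (1 := dual_vabs_vabs g x).
  apply Rle_trans with (1 := dle_app _ _ _ (vabs_le _ _ H1 H2) (vabs_nonneg x)).
  apply Rle_trans with (1 := dual_bound_app _ _ (vabs x) Hh). rewrite nrm_vabs. apply Rle_refl.
Qed.

Lemma midhull_form {E : BanachLattice} (L : dual E -> R) C d A c t : bounded_form L C ->
  (forall n, t <= L (d n)) -> midhull d A c -> t <= L c.
Proof.
  intros [HD [HZ _]] Ht. induction 1 as [n Hn|c k _ IH1 _ IH2]; [apply Ht|].
  rewrite HZ, HD. lra.
Qed.

(* Truncating the positive parts of [f] and [- f] at a large [H], the limits [p], [q] of the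
   positive parts are attained up to a small norm error by order continuity of the
   dual, and [p = q]; the truncations themselves are order bounded, hence have
   small midpoint combinations after subtracting their limit. *)
Lemma form_not_bounded_below {E : BanachLattice} (f : nat -> dual E) C (L : dual E -> R) CL eps :
  dual_order_continuous E -> (forall x, Un_cv (fun n => f n x) 0) ->
  0 <= C -> (forall n, dual_bound E (f n) C) -> bounded_form L CL ->
  let P n : dual E := vpos (f n) in let N n : dual E := vpos ([-] f n) in
  tails_vanish P L -> tails_vanish N L ->
  (forall x, rz0 [<=] x -> tails_vanish P (fun g => g x)) ->
  (forall x, rz0 [<=] x -> tails_vanish N (fun g => g x)) ->
  0 < eps -> (forall n, eps <= L (f n)) -> False.
Proof.
  intros Hoc Hf HC Hb HL P N HPL HNL HPx HNx Heps Hbig.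
  assert (HP0 : forall n, rz0 [<=] P n) by (intros; apply pos_nonneg).
  assert (HN0 : forall n, rz0 [<=] N n) by (intros; apply pos_nonneg).
  assert (HPb : forall n, dual_bound E (P n) C) by (intros; now apply dual_bound_vpos).
  assert (HNb : forall n, dual_bound E (N n) C).
  { intros n. apply dual_bound_vpos; [assumption|]. intros x.
    change (Rabs (- f n x) <= C * nrm x). rewrite Rabs_Ropp. apply Hb. }
  assert (HfPN : forall n, f n = P n [-] N n) by (intros; apply (decomp (f n : dual_riesz E))).
  destruct (ulim_dual P C HPb) as [p Hp]. destruct (ulim_dual N C HNb) as [q Hq].
  assert (Hpq : p = q).
  { apply dual_ext. intros x.
    assert (G := ucv_add _ _ _ _ (Hp x) (ucv_scal _ _ (-1) (Hq x))).
    assert (G2 := ucv_of_Un_cv _ _ (Hf x)).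
    assert (p x + -1 * q x = 0); [|lra].
    apply ucv_unique with (2 := G2). intros e He. apply FU_mono with (2 := G e He).
    intros n. rewrite (HfPN n). change ((P n [-] N n) x) with (P n x + - N n x).
    replace (P n x + -1 * N n x) with (P n x + - N n x) by ring. tauto. }
  set (trunc := fun (Q : nat -> dual E) (H g : dual E) =>
         forall x, ucv (fun n => (meet (Q n) H : dual E) x) (g x)).
  assert (Htr : forall (Q : nat -> dual E) (H : dual E), (forall n, rz0 [<=] Q n) -> (forall n, dual_bound E (Q n) C) ->
            rz0 [<=] H -> exists g, trunc Q H g).
  { intros Q H HQ HQb HH. apply ulim_dual with C. intros n.
    apply dual_bound_mono with (Q n); [now apply meet_glb|apply meet_l|apply HQb]. }
  assert (Htr_le : forall (Q : nat -> dual E) (H g : dual E), (forall n, rz0 [<=] Q n) -> rz0 [<=] H -> trunc Q H g ->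
            rz0 [<=] g /\ g [<=] H).
  { intros Q H g HQ HH Hg. split; intros x Hx.
    - apply (ucv_le (fun _ => 0) (fun n => (meet (Q n) H : dual E) x)); [|apply ucv_const|apply Hg].
      apply FU_all. intros n. apply dual_nonneg; [|assumption]. now apply meet_glb.
    - apply (ucv_le (fun n => (meet (Q n) H : dual E) x) (fun _ => H x)); [|apply Hg|apply ucv_const].
      apply FU_all. intros n. apply dle_app; [apply meet_r|assumption]. }
  assert (Htr_lim : forall (Q : nat -> dual E) (H g l : dual E), trunc Q H g -> (forall x, ucv (fun n => Q n x) (l x)) -> g [<=] l).
  { intros Q H g l Hg Hl x Hx.
    apply (ucv_le (fun n => (meet (Q n) H : dual E) x) (fun n => Q n x)); [|apply Hg|apply Hl].
    apply FU_all. intros n. apply dle_app; [apply meet_l|assumption]. }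
  assert (Htr_mono : forall (Q : nat -> dual E) (H1 H2 g1 g2 : dual E), H1 [<=] H2 -> trunc Q H1 g1 -> trunc Q H2 g2 -> g1 [<=] g2).
  { intros Q H1 H2 g1 g2 H12 Hg1 Hg2 x Hx.
    apply (ucv_le (fun n => (meet (Q n) H1 : dual E) x) (fun n => (meet (Q n) H2 : dual E) x));
      [|apply Hg1|apply Hg2].
    apply FU_all. intros n. apply dle_app; [|assumption]. apply meet_mono; [apply rz_le_refl|assumption]. }
  assert (Htr_close : forall (Q : nat -> dual E) (H g l : dual E) x e, rz0 [<=] x -> trunc Q H g -> (forall x, ucv (fun n => Q n x) (l x)) ->
            (forall n, Rabs ((vpos (Q n [-] H) : dual E) x) <= e) -> l x <= g x + e).
  { intros Q H g l x e Hx Hg Hl He.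
    apply (ucv_le (fun n => Q n x) (fun n => (meet (Q n) H : dual E) x + e)); [|apply Hl|].
    - apply FU_all. intros n. specialize (He n). apply Rabs_le_inv in He.
      rewrite (pos_sub_meet (Q n : dual_riesz E)) in He.
      change (- e <= Q n x + - (meet (Q n) H : dual E) x <= e) in He. lra.
    - apply ucv_add; [apply Hg|apply ucv_const]. }
  assert (HCL : 0 <= CL) by apply HL.
  destruct (HPL (eps / 8) ltac:(lra)) as [Ha [Ha0 Ha1]].
  destruct (HNL (eps / 8) ltac:(lra)) as [Hc [Hc0 Hc1]].
  set (H0 := (Ha [+] Hc : dual E)).
  (* The truncated limits grow with [H], so this family is directed downward. Its infimum is 0
     because the tails vanish uniformly at each positive [x]; order continuity then provides a
     member of small norm. *)
  set (D := fun g : E -> R => exists H pH qH : dual E, H0 [<=] H /\ trunc P H pH /\ trunc N H qH /\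
              g = ((p [-] pH) [+] (q [-] qH) : dual E)).
  assert (H00 : rz0 [<=] H0) by now apply add_nonneg.
  assert (HD_ex : forall H : dual E, H0 [<=] H -> exists g : dual E, exists pH qH : dual E, trunc P H pH /\ trunc N H qH /\
            g = ((p [-] pH) [+] (q [-] qH) : dual E)).
  { intros H HH. assert (G : rz0 [<=] H) by now apply rz_le_trans with H0.
    destruct (Htr P H HP0 HPb G) as [pH HpH]. destruct (Htr N H HN0 HNb G) as [qH HqH].
    now exists ((p [-] pH) [+] (q [-] qH) : dual E), pH, qH. }
  (* This gives CL eta <= eps / 8. At the end [L c] is at least eps - eps / 4 - eps / 8, yet at most
     eps / 8. *)
  set (eta := eps / (8 * (CL + 1))).
  assert (Heta : 0 < eta) by (apply Rdiv_lt_0_compat; lra).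
  assert (Heta2 : eta * (CL + 1) = eps / 8) by (unfold eta; field; lra).
  destruct (Hoc D) with (eps := eta) as [g [[H [pH [qH [HH [HpH [HqH ->]]]]]] [b [Hb1 [Hb2 Hb3]]]]].
  - intros g [H [pH [qH [_ [_ [_ ->]]]]]]. apply dualP.
  - destruct (HD_ex H0 (rz_le_refl _)) as [g [pH [qH [G1 [G2 G3]]]]].
    exists g, H0, pH, qH. rewrite G3. auto using rz_le_refl.
  - intros g1 g2 [H1 [p1 [q1 [HH1 [Hp1 [Hq1 ->]]]]]] [H2 [p2 [q2 [HH2 [Hp2 [Hq2 ->]]]]]].
    assert (HH1' : H1 [<=] join H1 H2) by apply join_l.
    assert (HH2' : H2 [<=] join H1 H2) by apply join_r.
    assert (HHj : H0 [<=] join H1 H2) by now apply rz_le_trans with H1.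
    destruct (HD_ex _ HHj) as [g [pj [qj [G1 [G2 G3]]]]].
    exists g. split; [|split].
    + exists (join H1 H2), pj, qj. rewrite G3. auto.
    + rewrite G3. assert (G : (p [-] pj) [+] (q [-] qj) [<=] (p [-] p1) [+] (q [-] q1)).
      { apply (vle2 _ _ _ _ _ _ (Htr_mono _ _ _ _ _ HH1' Hp1 G1) (Htr_mono _ _ _ _ _ HH1' Hq1 G2)). vs. }
      exact G.
    + rewrite G3. assert (G : (p [-] pj) [+] (q [-] qj) [<=] (p [-] p2) [+] (q [-] q2)).
      { apply (vle2 _ _ _ _ _ _ (Htr_mono _ _ _ _ _ HH2' Hp2 G1) (Htr_mono _ _ _ _ _ HH2' Hq2 G2)). vs. }
      exact G.
  - split; [apply in_dual_zero|]. split.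
    + intros g [H [pH [qH [HH [HpH [HqH ->]]]]]].
      assert (G : rz0 [<=] (p [-] pH) [+] (q [-] qH)).
      { apply (vle2 _ _ _ _ _ _ (Htr_lim _ _ _ _ HpH Hp) (Htr_lim _ _ _ _ HqH Hq)). vs. }
      exact G.
    + intros k _ Hk x Hx. apply Rnot_lt_le. intros Hlt.
      destruct (HPx x Hx (k x / 3) ltac:(lra)) as [H1 [H10 H11]].
      destruct (HNx x Hx (k x / 3) ltac:(lra)) as [H2 [H20 H21]].
      assert (GH : H0 [<=] H0 [+] H1 [+] H2) by (apply (vle2 _ _ _ _ _ _ H10 H20); vs).
      assert (GH1 : H1 [<=] H0 [+] H1 [+] H2) by (apply (vle2 _ _ _ _ _ _ H00 H20); vs).
      assert (GH2 : H2 [<=] H0 [+] H1 [+] H2) by (apply (vle2 _ _ _ _ _ _ H00 H10); vs).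
      destruct (HD_ex _ GH) as [g [pH [qH [G1 [G2 G3]]]]].
      assert (G4 : k x <= g x).
      { apply (Hk g); [|assumption]. exists (H0 [+] H1 [+] H2), pH, qH. rewrite G3. auto. }
      assert (G5 := Htr_close P _ _ _ x (k x / 3) Hx G1 Hp (fun n => H11 _ n GH1)).
      assert (G6 := Htr_close N _ _ _ x (k x / 3) Hx G2 Hq (fun n => H21 _ n GH2)).
      rewrite G3 in G4. change (k x <= (p x + - pH x) + (q x + - qH x)) in G4. lra.
  - assumption.
  - assert (HHa : Ha [<=] H) by (apply (vle2 _ _ _ _ _ _ HH Hc0); unfold H0; vs).
    assert (HHc : Hc [<=] H) by (apply (vle2 _ _ _ _ _ _ HH Ha0); unfold H0; vs).
    assert (HH0 : rz0 [<=] H) by now apply rz_le_trans with H0.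
    assert (H2 : rz0 [<=] 2 [*] H) by (apply scal_nonneg; auto; lra).
    (* The centred truncations: each of the two differences lies between -H and H, so 2 H dominates,
       and the ultrafilter limit is zero. *)
    set (d := fun n => (meet (P n) H [-] meet (N n) H [-] (pH [-] qH) : dual E)).
    destruct (Htr_le P H pH HP0 HH0 HpH) as [p0 p1]. destruct (Htr_le N H qH HN0 HH0 HqH) as [q0 q1].
    destruct (midhull_small_norm (2 [*] H) H2 d) with (eps := eta) as [c [Hc2 Hc3]]; auto.
    + intros n.
      assert (m0 : rz0 [<=] meet (P n) H) by now apply meet_glb.
      assert (m1 : meet (P n) H [<=] H) by apply meet_r.
      assert (m2 : rz0 [<=] meet (N n) H) by now apply meet_glb.
      assert (m3 : meet (N n) H [<=] H) by apply meet_r.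
      split; unfold d.
      * apply (vle2 _ _ _ _ _ _ (le_add_mono _ _ _ _ m1 m2) (le_add_mono _ _ _ _ p0 q1)). vs.
      * apply (vle2 _ _ _ _ _ _ (le_add_mono _ _ _ _ m3 m0) (le_add_mono _ _ _ _ q0 p1)). vs.
    + intros x.
      assert (G1 := ucv_add _ _ _ _ (HpH x) (ucv_scal _ _ (-1) (HqH x))).
      assert (G2 := ucv_add _ _ _ _ G1 (ucv_const (- (pH x + - qH x)))).
      replace (pH x + -1 * qH x + - (pH x + - qH x)) with 0 in G2 by ring.
      intros e He. apply FU_mono with (2 := G2 e He). intros n.
      change (d n x) with ((meet (P n) H : dual E) x + - (meet (N n) H : dual E) x + - (pH x + - qH x)).
      replace (-1 * (meet (N n) H : dual E) x) with (- (meet (N n) H : dual E) x) by ring. tauto.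
    (* Because p = q, the difference pH - qH equals (q - qH) - (p - pH), so it is dominated by the
       chosen member of [D]. *)
    + assert (HLpq : Rabs (L (pH [-] qH)) <= CL * eta).
      { apply HL; [lra|].
        apply dual_bound_dominated with ((p [-] pH) [+] (q [-] qH) : dual E).
        - assert (G1 := Htr_lim _ _ _ _ HpH Hp). assert (G2 := Htr_lim _ _ _ _ HqH Hq).
          rewrite <- Hpq in *. split.
          + apply (vle2 _ _ _ _ _ _ G1 G1). vs.
          + apply (vle2 _ _ _ _ _ _ G2 G2). vs.
        - intros x. apply Rle_trans with (1 := Hb3 x). apply Rmult_le_compat_r; [apply nrm_nonneg|lra]. }
      assert (HLd : forall n, eps - eps / 4 - CL * eta <= L (d n)).
      { intros n.
        assert (G1 := Ha1 H n HHa). assert (G2 := Hc1 H n HHc). specialize (Hbig n).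
        rewrite (HfPN n) in Hbig.
        assert (G3 : P n [-] N n = d n [+] (pH [-] qH) [+] (vpos (P n [-] H) [-] vpos (N n [-] H))).
        { rewrite (pos_sub_meet (P n : dual_riesz E)), (pos_sub_meet (N n : dual_riesz E)). unfold d. vs. }
        rewrite G3 in Hbig.
        assert (HLN : forall g : dual E, L ([-] g) = - L g).
        { intros g. destruct HL as [_ [HLZ _]]. rewrite (rz_oppE (g : dual_riesz E)), HLZ. ring. }
        destruct HL as [HLD _]. rewrite !HLD, !HLN in Hbig. rewrite HLD, HLN in HLpq.
        apply Rabs_le_inv in G1, G2, HLpq. lra. }
      assert (G1 := midhull_form L CL d _ c _ HL HLd Hc2).
      assert (G2 : Rabs (L c) <= CL * eta) by (apply HL; [lra|assumption]).
      apply Rabs_le_inv in G2. lra.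
Qed.

Theorem theorem4p3 (E : BanachLattice) (u0 : E) (G : (E -> E) -> Prop) :
  sigma_interpolation E ->
  dual_order_continuous E ->
  bl_le bl_zero u0 ->
  (forall T, G T -> positive_linear_op E T /\ adjoint_lattice_hom E T) ->
  (forall x : E, bl_le bl_zero x ->
     exists T, G T /\ bl_le x (bl_scal (bl_norm x) (T u0))) ->
  (forall (xs : nat -> E) (Ts : nat -> E -> E),
     (forall n, bl_le bl_zero (xs n) /\ bl_le (xs n) u0) ->
     (forall n m, n <> m -> bl_disjoint E (xs n) (xs m)) ->
     (forall n, G (Ts n)) ->
     exists v : E, bl_le bl_zero v /\ forall n, bl_le (Ts n (xs n)) v) ->
  grothendieck E.
Proof.
  intros Hint Hoc Hu0 Hhom Hdom Hbdd fs f Hfs Hf Hlim.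
  (* A weak limit must agree with the weak-* limit at evaluation functionals, so [f] is the only
     candidate. *)
  exists f. split; [assumption|]. intros phi [phiD [phiZ [C0 phiB]]].
  set (L := fun g : dual E => phi g).
  assert (HL : bounded_form L (Rabs C0)).
  { split; [|split; [|split]].
    - intros g h. exact (phiD g h (dualP g) (dualP h)).
    - intros a g. exact (phiZ a g (dualP g)).
    - apply Rabs_pos.
    - intros g c Hc Hg. apply Rle_trans with (1 := phiB g c (dualP g) Hc Hg).
      apply Rmult_le_compat_r; [assumption|apply Rle_abs]. }
  set (F := fun n => MkDual (fs n) (Hfs n) : dual E). set (f0 := MkDual f Hf : dual E).
  apply NNPP. intros Hn.
  assert (He : exists eps, 0 < eps /\ forall N, exists n, (N <= n)%nat /\ eps <= Rabs (L (F n [-] f0))).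
  { apply NNPP. intros Hn1. apply Hn. intros eps Heps.
    apply NNPP. intros Hn2. apply Hn1. exists eps. split; [assumption|].
    intros N. apply NNPP. intros Hn3. apply Hn2. exists N. intros n HnN.
    apply Rnot_le_lt. intros Hle. apply Hn3. exists n. split; [assumption|].
    rewrite (bounded_formB L _ _ _ HL). exact Hle. }
  destruct He as [eps [Heps He]].
  destruct (nat_choice _ _ He) as [sigma Hsigma].
  (* The signs turn the lower bound on the absolute value of [L] into one on [L] itself, without
     disturbing weak-* convergence to zero. *)
  set (sg := fun n => if Rle_dec 0 (L (F (sigma n) [-] f0)) then 1 else -1).
  assert (Hsg : forall n, Rabs (sg n) = 1).
  { intros n. unfold sg. destruct (Rle_dec 0 (L (F (sigma n) [-] f0)));
      [rewrite Rabs_pos_eq|rewrite Rabs_left]; lra. }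
  set (h := fun n => (sg n [*] (F (sigma n) [-] f0) : dual E)).
  assert (Hhapp : forall n x, h n x = sg n * (fs (sigma n) x - f x)) by reflexivity.
  assert (Hhnull : forall x, Un_cv (fun n => h n x) 0).
  { intros x e Hpe. destruct (Hlim x e Hpe) as [N HN]. exists N. intros n HnN.
    unfold R_dist. rewrite Rminus_0_r, Hhapp, Rabs_mult, Hsg, Rmult_1_l.
    apply HN. destruct (Hsigma n). lia. }
  assert (Hhnull' : forall x, Un_cv (fun n => ([-] h n : dual E) x) 0).
  { intros x e Hpe. destruct (Hhnull x e Hpe) as [N HN]. exists N. intros n HnN.
    specialize (HN n HnN). unfold R_dist in *. rewrite Rminus_0_r in *.
    change (([-] h n : dual E) x) with (- h n x). now rewrite Rabs_Ropp. }
  assert (Hub : forall x, exists B, forall n, Rabs (h n x) <= B).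
  { intros x. destruct (maj_by_pos _ (exist _ 0 (Hhnull x))) as [B [_ HB]]. now exists B. }
  destruct (uniform_boundedness h Hub) as [C [HC Hhb]].
  assert (Hhb' : forall n, dual_bound E ([-] h n : dual E) C).
  { intros n x. change (Rabs (- h n x) <= C * nrm x). rewrite Rabs_Ropp. apply Hhb. }
  apply (form_not_bounded_below h C L (Rabs C0) eps); auto.
  - exact (tails_vanish_form Hint h C Hhnull HC Hhb u0 G Hu0 Hhom Hdom Hbdd L _ HL).
  - exact (tails_vanish_form Hint _ C Hhnull' HC Hhb' u0 G Hu0 Hhom Hdom Hbdd L _ HL).
  - exact (tails_vanish_eval Hint h C Hhnull HC Hhb).
  - exact (tails_vanish_eval Hint _ C Hhnull' HC Hhb').
  - intros n. destruct (Hsigma n) as [_ H1]. unfold h. destruct HL as [_ [HZ _]]. rewrite HZ.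
    unfold sg. destruct (Rle_dec 0 (L (F (sigma n) [-] f0)));
      [rewrite Rabs_pos_eq in H1|rewrite Rabs_left in H1]; lra.
Qed.
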